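(* If $M\subset\mathbb{C}P^n$ is a complex submanifold, then $M$ is austere.
   Context: $\mathbb{C}P^n$ carries the Fubini–Study metric for which the Hopf fibration $\pi:S^{2n+1}\to\mathbb{C}P^n$ from the unit sphere in $\mathbb{C}^{n+1}$ is a Riemannian submersion. $NM$ is the normal bundle of $M$ with respect to this metric. Submanifolds are smooth and may be immersed; statements about $\Phi(NM)$ are then read via the immersion $NM\to\mathcal{M}$ obtained by composing $NM\to T\mathbb{C}P^n$ with $\Phi$. For vectors in $\mathbb{C}^{n+1}$ the dot product is $\mathbb{C}$-bilinear. Let $B=\{(\zeta,\xi)\in\mathbb{C}^{n+1}\times\mathbb{C}^{n+1} : \zeta\neq 0,\ \xi\cdot\overline{\zeta}=0\}$. Then $T\mathbb{C}P^n\cong B/\mathbb{C}^*$, where $\lambda\in\mathbb{C}^*$ acts by $(\zeta,\xi)\mapsto(\lambda\zeta,\lambda\xi)$, the class of $(\zeta,\xi)$ being the tangent vector $\frac{d}{ds}\big|_{s=0}[\zeta+s\xi]$ at $[\zeta]$. $\mathcal{M}\subset\mathbb{C}P^n\times\mathbb{C}P^n$ is the open set of pairs $([z],[w])$ with $\sum_{i=0}^n z_iw_i\neq 0$. The map $\Phi:T\mathbb{C}P^n\to\mathcal{M}$ is the bijective identification (diffeomorphism) induced by $$(\zeta,\xi)\mapsto\Big((\cosh\mu)\zeta+\mathrm{i}\tfrac{\sinh\mu}{\mu}\xi\,;\ (\cosh\mu)\overline{\zeta}+\mathrm{i}\tfrac{\sinh\mu}{\mu}\overline{\xi}\Big),\qquad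 \mu=\frac{|\xi|}{|\zeta|}$$ (with $\sinh\mu/\mu=1$ at $\mu=0$). The Stenzel Kähler form on $\mathcal{M}$ is $\Omega=\mathrm{i}\,\partial\bar\partial f(\mathcal{N})$, where $\mathcal{N}=\mathcal{A}/|\mathcal{B}|^2$, $\mathcal{A}=\sum_{j,k=0}^n|z_jw_k|^2$, $\mathcal{B}=\sum_{j=0}^n z_jw_j$, and $f'(\mathcal{N})=\mathcal{N}^{-1/2}$ (so $f(\mathcal{N})=2\sqrt{\mathcal{N}}$ up to an additive constant). The holomorphic volume form $\Theta$ on $\mathcal{M}$ is, in affine coordinates $Z_a=z_a/z_0$, $W_a=w_a/w_0$ ($1\le a\le n$), $\Theta=(1+\sum_a Z_aW_a)^{-(n+1)}\,dZ_1\wedge\cdots\wedge dZ_n\wedge dW_1\wedge\cdots\wedge dW_n$, up to a constant factor. Definition: $M$ is austere if its normal bundle is special Lagrangian (with some constant phase) in $T\mathbb{C}P^n$ with respect to the Stenzel Calabi–Yau structure, i.e. there is a constant $\phi\in\mathbb{R}$ such that $\Omega|_{\Phi(NM)}\equiv0$ and $\operatorname{Im}(e^{\mathrm{i}\phi}\Theta)|_{\Phi(NM)}\equiv 0$. *)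

(* Defs.v *)
From HB Require Import structures.
From mathcomp Require Import all_boot all_order all_algebra.
From mathcomp Require Import all_classical all_reals all_analysis.
From mathcomp Require Import complex ring.

Set Implicit Arguments.
Unset Strict Implicit.
Unset Printing Implicit Defensive.

Import Order.TTheory GRing.Theory Num.Theory.
Import numFieldNormedType.Exports.

Local Open Scope classical_set_scope.
Local Open Scope ring_scope.
Local Open Scope complex_scope.

Section Smooth.
Variables (R : realType) (V : normedModType R).

(* For V finite dimensional, which is the only case used, this is the usual
   C^k condition on the open set U. *)
Fixpoint Ck (k : nat) (U : set V) (f : V -> R) : Prop :=
  if k is k'.+1 then
    (forall x, U x -> differentiable f x) /\
    (forall v, Ck k' U (fun x => 'D_v f x))
  else forall x, U x -> {for x, continuous f}.

Definition smooth_on (U : set V) (f : V -> R) : Prop := forall k, Ck k U f.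

Definition rsmooth_on m (U : set V) (f : V -> 'rV[R]_m) : Prop :=
  forall j, smooth_on U (fun x => f x 0 j).

Definition csmooth_on N (U : set V) (f : V -> 'rV[R[i]]_N) : Prop :=
  forall j, smooth_on U (fun x => complex.Re (f x 0 j)) /\
            smooth_on U (fun x => complex.Im (f x 0 j)).

(* Real directional derivatives of C-valued and C^N-valued functions. *)
Definition cderive (v : V) (g : V -> R[i]) (x : V) : R[i] :=
  'D_v (fun y => complex.Re (g y)) x +i* 'D_v (fun y => complex.Im (g y)) x.

Definition cvderive N (v : V) (f : V -> 'rV[R[i]]_N) (x : V) : 'rV[R[i]]_N :=
  \row_j cderive v (fun y => f y 0 j) x.

End Smooth.

Section Wirtinger.
Variable R : realType.

(* C^N is identified with R^(N + N) by z |-> (Re z, Im z). *)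
Definition toC N (x : 'rV[R]_(N + N)) : 'rV[R[i]]_N :=
  \row_j (x 0 (lshift N j) +i* x 0 (rshift N j)).

Definition ofC N (z : 'rV[R[i]]_N) : 'rV[R]_(N + N) :=
  row_mx (\row_j complex.Re (z 0 j)) (\row_j complex.Im (z 0 j)).

Definition d_dz N (j : 'I_N) (g : 'rV[R]_(N + N) -> R[i]) x : R[i] :=
  2%:R^-1 * (cderive (delta_mx 0 (lshift N j)) g x
             - 'i * cderive (delta_mx 0 (rshift N j)) g x).

Definition d_dzbar N (j : 'I_N) (g : 'rV[R]_(N + N) -> R[i]) x : R[i] :=
  2%:R^-1 * (cderive (delta_mx 0 (lshift N j)) g x
             + 'i * cderive (delta_mx 0 (rshift N j)) g x).

Definition holomorphic_on k N (U : set 'rV[R]_(k + k))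
    (f : 'rV[R]_(k + k) -> 'rV[R[i]]_N) : Prop :=
  csmooth_on U f /\
  forall x, U x -> forall (a : 'I_k) (j : 'I_N),
    d_dzbar a (fun y => f y 0 j) x = 0.

(* The 2-form i * \partial \bar\partial F on C^N at the point z; the tangent
   vector X in C^N has dz_a(X) = X_a and d\bar z_b(X) = conj X_b. *)
Definition i_ddbar N (F : 'rV[R[i]]_N -> R) (z X Y : 'rV[R[i]]_N) : R[i] :=
  'i * \sum_(a < N) \sum_(b < N)
     d_dz a (d_dzbar b (fun x => (F (toC x))%:C)) (ofC z) *
     (X 0 a * conjc (Y 0 b) - Y 0 a * conjc (X 0 b)).

End Wirtinger.

Section ProjectiveSpace.
Variable R : realType.

(* Points of CP^n are the complex lines of C^(n+1). *)
Definition CP (n : nat) := {L : {vspace 'rV[R[i]]_n.+1} | \dim L == 1%N}.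

(* p = [z] *)
Definition hcoord n (p : CP n) (z : 'rV[R[i]]_n.+1) : Prop :=
  z != 0 /\ sval p = <[z]>%VS.

Definition cdot N (x y : 'rV[R[i]]_N) : R[i] := \sum_j x 0 j * y 0 j.

Definition cconj N (x : 'rV[R[i]]_N) : 'rV[R[i]]_N := map_mx conjc x.

Definition cnorm N (x : 'rV[R[i]]_N) : R :=
  Num.sqrt (complex.Re (cdot x (cconj x))).

(* The horizontal vector xi for which (zeta, xi) represents the velocity at
   s = 0 of [zeta + s eta]. *)
Definition hproj n (zeta eta : 'rV[R[i]]_n.+1) : 'rV[R[i]]_n.+1 :=
  eta - (cdot eta (cconj zeta) / cdot zeta (cconj zeta)) *: zeta.

(* The Fubini-Study metric at [zeta] on vectors represented by (zeta, xi) and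
   (zeta, eta); for |zeta| = 1 it is the round metric on horizontal vectors. *)
Definition fubini_study n (zeta xi eta : 'rV[R[i]]_n.+1) : R :=
  complex.Re (cdot xi (cconj eta)) / cnorm zeta ^+ 2.

End ProjectiveSpace.

Section Manifold.
Variable R : realType.

Section Parametrization.
Variables (m : nat) (T : topologicalType).

(* x restricts to a homeomorphism from the open set U onto an open set. *)
Definition local_param (U : set 'rV[R]_m) (x : 'rV[R]_m -> T) : Prop :=
  [/\ open U,
      forall u v, U u -> U v -> x u = x v -> u = v &
      forall A : set 'rV[R]_m, A `<=` U -> (open A <-> open (x @` A))].

(* y^-1 \o x is smooth where it is defined. *)
Definition smooth_change (U : set 'rV[R]_m) (x : 'rV[R]_m -> T)
    (U' : set 'rV[R]_m) (y : 'rV[R]_m -> T) : Prop :=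
  exists2 tau : 'rV[R]_m -> 'rV[R]_m,
    rsmooth_on (U `&` x @^-1` (y @` U')) tau &
    forall u, U u -> (y @` U') (x u) -> U' (tau u) /\ y (tau u) = x u.

End Parametrization.

(* Smooth manifolds of dimension m; an atlas is given by its inverse charts. *)
Record manifold (m : nat) := Manifold {
  mspace :> topologicalType;
  mchart : Type;
  mdom : mchart -> set 'rV[R]_m;
  mpar : mchart -> 'rV[R]_m -> mspace;
  _ : hausdorff_space mspace;
  _ : @second_countable mspace;
  mlocal_param : forall a, local_param (mdom a) (mpar a);
  mcover : forall p, exists a, exists2 u, mdom a u & mpar a u = p;
  mcompat : forall a b, smooth_change (mdom a) (mpar a) (mdom b) (mpar b)
}.

(* The parametrizations belonging to the maximal atlas of M. *)
Definition smooth_param m (M : manifold m)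
    (U : set 'rV[R]_m) (x : 'rV[R]_m -> M) : Prop :=
  local_param U x /\
  forall a, smooth_change U x (mdom a) (@mpar m M a) /\
            smooth_change (mdom a) (@mpar m M a) U x.

(* sigma is a smooth lift to C^(n+1) \ {0}, on a neighbourhood W of u
   contained in U, of the map f : U -> CP^n. *)
Definition local_lift n m (U : set 'rV[R]_m) (f : 'rV[R]_m -> CP R n)
    (u : 'rV[R]_m) (W : set 'rV[R]_m)
    (sigma : 'rV[R]_m -> 'rV[R[i]]_n.+1) : Prop :=
  [/\ open W, W u, W `<=` U, csmooth_on W sigma &
      forall y, W y -> hcoord (f y) (sigma y)].

Definition smooth_map n m (M : manifold m) (F : M -> CP R n) : Prop :=
  forall (a : mchart M) u, mdom a u ->
    exists W sigma, local_lift (mdom a) (F \o @mpar m M a) u W sigma.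

Definition immersion n m (M : manifold m) (F : M -> CP R n) : Prop :=
  smooth_map F /\
  forall (a : mchart M) u W sigma, mdom a u ->
    local_lift (mdom a) (F \o @mpar m M a) u W sigma ->
    forall v, hproj (sigma u) (cvderive v sigma u) = 0 -> v = 0.

(* An immersion F of a smooth manifold M of real dimension 2k is a complex
   submanifold of complex dimension k if the smooth structure of M admits, near
   every point, a parametrization from an open subset of C^k on which F is
   holomorphic; as F is an immersion, the changes between these
   parametrizations are then holomorphic. *)
Definition complex_submanifold n k (M : manifold (k + k)) (F : M -> CP R n)
    : Prop :=
  immersion F /\
  forall p : M, exists (U : set 'rV[R]_(k + k)) (x : 'rV[R]_(k + k) -> M),
    [/\ smooth_param U x, (x @` U) p &
        forall u, U u -> exists W sigma,
          local_lift U (F \o x) u W sigma /\ holomorphic_on W sigma].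

(* (zeta, eta) represents a vector of dF (T_p M). *)
Definition tangent_rep n m (M : manifold m) (F : M -> CP R n) (p : M)
    (zeta eta : 'rV[R[i]]_n.+1) : Prop :=
  exists (a : mchart M) u v W sigma,
    [/\ mdom a u /\ mpar a u = p,
        local_lift (mdom a) (F \o @mpar m M a) u W sigma,
        sigma u = zeta &
        eta = hproj zeta (cvderive v sigma u)].

(* (zeta, xi) represents a vector of the normal space N_p M. *)
Definition normal_rep n m (M : manifold m) (F : M -> CP R n) (p : M)
    (zeta xi : 'rV[R[i]]_n.+1) : Prop :=
  [/\ hcoord (F p) zeta, cdot xi (cconj zeta) = 0 &
      forall eta, tangent_rep F p zeta eta -> fubini_study zeta xi eta = 0].

End Manifold.

Lemma det_corner (K : comNzRingType) n (a : K) (A C : 'M[K]_n) (c : 'cV[K]_n)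
    (B D : 'M[K]_n) (d : 'cV[K]_n) :
  \det (block_mx A (row_mx c B) (col_mx 0 C) (block_mx a%:M 0 d D)
        : 'M[K]_(n + (1 + n))) = a * \det (block_mx A B C D).
Proof.
set S := (block_mx A (row_mx c B) _ _).
have e : (n + (1 + n)).-1 = (n + n)%N by rewrite addnCA.
pose i0 : 'I_(n + (1 + n)) := rshift n (lshift n 0).
have S0 j : S i0 j = a *+ (j == i0).
  rewrite /S /i0 /block_mx col_mxEd; case: (split_ordP j) => l ->.
    by rewrite row_mxEl col_mxEu mxE eq_lrshift.
  rewrite row_mxEr col_mxEu eq_rshift; case: (split_ordP l) => l' ->.
    by rewrite row_mxEl mxE !ord1.
  by rewrite row_mxEr mxE eq_rlshift.
rewrite (expand_det_row S i0) (bigD1 i0) //= big1 ?addr0; last first.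
  by move=> j /negPf ji; rewrite S0 ji mul0r.
rewrite S0 eqxx /cofactor addnn -mul2n exprM sqrrN expr1n expr1n mul1r.
congr (_ * _).
have dcast (N N' : nat) (E : N = N') (M : 'M[K]_N) :
  \det M = \det (castmx (E, E) M) by case: N' / E; rewrite castmx_id.
rewrite (dcast _ _ e); congr (\det _); apply/matrixP => i j; rewrite castmxE /= 2!mxE.
have lu (l : 'I_n) : lift i0 (cast_ord (esym e) (lshift n l)) = lshift (1 + n) l.
  by apply: val_inj; rewrite /= /bump /= addn0 leqNgt ltn_ord.
have ld (l : 'I_n) : lift i0 (cast_ord (esym e) (rshift n l)) = rshift n (rshift 1 l).
  by apply: val_inj; rewrite /= /bump /= addn0 leq_addr addnCA.
case: (split_ordP i) => i' ->; case: (split_ordP j) => j' ->;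
  rewrite ?lu ?ld /S ?(block_mxEul, block_mxEur, block_mxEdl, block_mxEdr);
  by rewrite ?(row_mxEr, col_mxEd, row_mxEl, col_mxEu) ?(block_mxEdr).
Qed.

Lemma det_corner0 (K : comNzRingType) n p (a : K) (A : 'M[K]_n) (c : 'cV[K]_n)
    (B : 'M[K]_(n, p)) (e : 'cV[K]_p) (C : 'M[K]_(p, n)) (D : 'M[K]_p) :
  \det (block_mx (block_mx a%:M 0 c A) (col_mx 0 B) (row_mx e C) D
        : 'M[K]_((1 + n) + p)) = a * \det (block_mx A B C D).
Proof.
set S := (block_mx (block_mx _ _ _ _) _ _ _).
pose i0 : 'I_((1 + n) + p) := lshift p (lshift n 0).
have S0 j : S i0 j = a *+ (j == i0).
  rewrite /S /i0; case: (split_ordP j) => l ->.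
    rewrite block_mxEul eq_lshift; case: (split_ordP l) => l' ->.
      by rewrite block_mxEul mxE !ord1.
    by rewrite block_mxEur mxE eq_rlshift.
  by rewrite block_mxEur col_mxEu mxE eq_rlshift.
rewrite (expand_det_row S i0) (bigD1 i0) //= big1 ?addr0; last first.
  by move=> j /negPf ji; rewrite S0 ji mul0r.
rewrite S0 eqxx /cofactor /= expr0 mul1r.
congr (_ * \det _); apply/matrixP => i j; rewrite 2!mxE.
have lu (l : 'I_n) : lift i0 (lshift p l) = lshift p (rshift 1 l).
  by apply: val_inj.
have ld (l : 'I_p) : lift i0 (rshift n l) = rshift (1 + n) l.
  by apply: val_inj.
case: (split_ordP i) => i' ->; case: (split_ordP j) => j' ->;
  rewrite ?lu ?ld /S ?(block_mxEul, block_mxEur, block_mxEdl, block_mxEdr);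
  by rewrite ?(row_mxEr, col_mxEd, row_mxEl, col_mxEu) ?(block_mxEdr).
Qed.

Section AffineCoordinates.
Variable K : fieldType.

(* The differentials at z of the functions z_a / z_0, 1 <= a <= n, evaluated on
   the rows of X. *)
Definition daffine n r (z : 'rV[K]_n.+1) (X : 'M[K]_(r, n.+1)) : 'M[K]_(r, n) :=
  \matrix_(b, a) ((X b (lift 0 a) * z 0 0 - z 0 (lift 0 a) * X b 0)
                  / z 0 0 ^+ 2).

Definition Taff n (z : 'rV[K]_n.+1) : 'M[K]_(1 + n) :=
  block_mx 1%:M (- \row_a (z 0 (lift 0 a) / z 0 0 ^+ 2)) 0 (z 0 0)^-1%:M.

Lemma mul_Taff n r (z : 'rV[K]_n.+1) (X : 'M[K]_(r, n.+1)) : z 0 0 != 0 ->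
  (X : 'M[_]_(r, 1 + n)) *m Taff z = row_mx (col 0 X) (daffine z X).
Proof.
move=> z0; rewrite -{1}(@hsubmxK _ r 1 n X) /Taff mul_row_block.
rewrite mulmx1 mulmx0 addr0; congr row_mx.
  by apply/matrixP => i j; rewrite !mxE ord1; congr (X _ _); apply: val_inj.
apply/matrixP => i j; rewrite mul_mx_scalar !mxE big_ord1 !mxE.
have -> : lshift n (0 : 'I_1) = 0 by apply: val_inj.
have -> : rshift 1 j = lift 0 j by apply: val_inj.
by field.
Qed.

Lemma daffine_self n (z : 'rV[K]_n.+1) : daffine z z = 0.
Proof. by apply/matrixP => i j; rewrite !mxE ord1 subrr mul0r. Qed.
Lemma daffine0 n r (z : 'rV[K]_n.+1) : daffine z (0 : 'M[_]_(r,_)) = 0.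
Proof. by apply/matrixP => i j; rewrite !mxE !(mul0r, mulr0, subr0). Qed.

Lemma det_Taff n (z : 'rV[K]_n.+1) : \det (Taff z) = (z 0 0)^-1 ^+ n.
Proof. by rewrite det_ublock det1 mul1r det_scalar. Qed.

Lemma det_affine n (z w : 'rV[K]_n.+1) (X : 'M[K]_(n + n, n.+1 + n.+1)) :
  z 0 0 != 0 -> w 0 0 != 0 ->
  \det (col_mx (col_mx (row_mx z 0) (usubmx X))
               (col_mx (row_mx 0 w) (dsubmx X)) : 'M[K]_(n.+1 + n.+1)) =
  (z 0 0 * w 0 0) ^+ n.+1 * 
    \det (row_mx (daffine z (lsubmx X)) (daffine w (rsubmx X))).
Proof.
move=> z0 w0.
set M := (X in \det X = _).
pose T : 'M[K]_((1 + n) + (1 + n)) := block_mx (Taff z) 0 0 (Taff w).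
have dT : \det T = (z 0 0 * w 0 0)^-1 ^+ n.
  by rewrite det_ublock !det_Taff -exprMn invfM.
have zw0 : z 0 0 * w 0 0 != 0 by rewrite mulf_neq0.
have -> : \det M = (z 0 0 * w 0 0) ^+ n * \det ((M : 'M[_]_((1 + n) + (1 + n))) *m T).
  by rewrite det_mulmx dT mulrCA -exprMn divff // expr1n mulr1.
rewrite exprSr -mulrA; congr (_ * _).
pose Y := usubmx X; pose Z := dsubmx X.
have -> : (M : 'M[_]_((1 + n) + (1 + n))) *m T =
  block_mx (block_mx (z 0 0)%:M 0 (col 0 (lsubmx Y)) (daffine z (lsubmx Y)))
   (col_mx 0 (row_mx (col 0 (rsubmx Y)) (daffine w (rsubmx Y))))
   (row_mx (col_mx 0 (col 0 (lsubmx Z))) (col_mx 0 (daffine z (lsubmx Z))))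
   (block_mx (w 0 0)%:M 0 (col 0 (rsubmx Z)) (daffine w (rsubmx Z))).
  have mT r (P Q : 'M[K]_(r, 1 + n)) : row_mx P Q *m T =
     row_mx (row_mx (col 0 (P : 'M[_]_(r, n.+1))) (daffine z P))
            (row_mx (col 0 (Q : 'M[_]_(r, n.+1))) (daffine w Q)).
    by rewrite mul_row_block !mulmx0 addr0 add0r !mul_Taff.
  have c11 (v : 'rV[K]_n.+1) : col 0 v = (v 0 0)%:M.
    by apply/matrixP => i j; rewrite !mxE !ord1.
  rewrite /M -/Y -/Z !mul_col_mx -(hsubmxK Y) -(hsubmxK Z) !mT.
  rewrite !row_mxKl !row_mxKr !daffine_self !daffine0 !c11 !mxE.
  have b p1 p2 q1 q2 (P1 : 'M[K]_(p1, q1)) (P2 : 'M[_]_(p2, q1)) (P3 : 'M[_]_(p1, q2))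
      (P4 : 'M[_]_(p2, q2)) :
     row_mx (col_mx P1 P2) (col_mx P3 P4) = col_mx (row_mx P1 P3) (row_mx P2 P4).
    by rewrite -block_mxEh.
  have s0 : (0%:M : 'M[K]_1) = 0 by apply/matrixP => i j; rewrite !mxE mul0rn.
  by rewrite /block_mx !b s0 !row_mx0.
rewrite det_corner0 det_corner mulrA; congr (_ * \det _).
rewrite block_mxEh; congr row_mx; apply/matrixP => i j; rewrite /Y /Z;
  by case: (split_ordP i) => i' ->; rewrite ?(col_mxEu, col_mxEd) !mxE.
Qed.
End AffineCoordinates.

Section Stenzel.
Variable R : realType.

Definition cosh (x : R) : R := (expR x + expR (- x)) / 2.
Definition sinh (x : R) : R := (expR x - expR (- x)) / 2.
Definition sinhc (x : R) : R := if x == 0 then 1 else sinh x / x.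

(* A pair ([z], [w]) is represented by row_mx z w in C^((n+1) + (n+1)). *)
Definition Phi n (zeta xi : 'rV[R[i]]_n.+1) : 'rV[R[i]]_(n.+1 + n.+1) :=
  let mu := cnorm xi / cnorm zeta in
  row_mx ((cosh mu)%:C *: zeta + ('i * (sinhc mu)%:C) *: xi)
         ((cosh mu)%:C *: cconj zeta + ('i * (sinhc mu)%:C) *: cconj xi).

Definition calN n (q : 'rV[R[i]]_(n.+1 + n.+1)) : R :=
  let z := lsubmx q in let w := rsubmx q in
  (\sum_j \sum_k complex.Re `|z 0 j * w 0 k| ^+ 2)
  / complex.Re `|cdot z w| ^+ 2.

(* Forms on the open set of pairs ([z], [w]) with z . w != 0 are written in
   homogeneous coordinates, i.e. pulled back by the holomorphic submersion
   (z, w) |-> ([z], [w]). Such a pullback commutes with \partial and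
   \bar\partial, and evaluating it on lifts of tangent vectors gives the value
   of the form on those vectors, whatever the lifts. *)
Definition Omega n (q X Y : 'rV[R[i]]_(n.+1 + n.+1)) : R[i] :=
  i_ddbar (fun q' => 2 * Num.sqrt (calN q')) q X Y.

(* The 2n rows of X are the arguments. This is (z . w)^-(n+1) times the wedge
   product of the contractions of dz_0 /\ ... /\ dz_n and dw_0 /\ ... /\ dw_n
   with the vector fields (z, 0) and (0, w); Theta_affine below is its
   expression in affine coordinates. *)
Definition Theta n (q : 'rV[R[i]]_(n.+1 + n.+1))
    (X : 'M[R[i]]_(n + n, n.+1 + n.+1)) : R[i] :=
  let z := lsubmx q in let w := rsubmx q in
  (cdot z w ^+ n.+1)^-1 *
  \det (col_mx (col_mx (row_mx z 0) (usubmx X))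
               (col_mx (row_mx 0 w) (dsubmx X)) : 'M[R[i]]_(n.+1 + n.+1)).

Lemma Theta_affine n (q : 'rV[R[i]]_(n.+1 + n.+1))
    (X : 'M[R[i]]_(n + n, n.+1 + n.+1)) :
  let z := lsubmx q in let w := rsubmx q in
  z 0 0 != 0 -> w 0 0 != 0 ->
  Theta q X =
    ((1 + \sum_(a < n) (z 0 (lift 0 a) / z 0 0) * (w 0 (lift 0 a) / w 0 0))
       ^+ n.+1)^-1 *
    \det (row_mx (daffine z (lsubmx X)) (daffine w (rsubmx X))).
Proof.
move=> z w z0 w0; rewrite /Theta -/z -/w det_affine // mulrA; congr (_ * _).
have -> : cdot z w = z 0 0 * w 0 0 *
    (1 + \sum_(a < n) (z 0 (lift 0 a) / z 0 0) * (w 0 (lift 0 a) / w 0 0)).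
  rewrite /cdot big_ord_recl mulrDr mulr1 mulr_sumr; congr (_ + _).
  by apply: eq_bigr => a _; field; rewrite z0 w0.
by rewrite exprMn invfM mulrAC mulVf ?mul1r // expf_neq0 // mulf_neq0.
Qed.

End Stenzel.

Section Austere.
Variable R : realType.

(* X is the velocity at t = 0 of Phi (zeta(t), xi(t)) for some smooth curve
   (p(t), [zeta(t), xi(t)]) in the normal bundle of F starting at
   (p, [zeta, xi]). *)
Definition tangent_PhiN n m (M : manifold R m) (F : M -> CP R n) (p : M)
    (zeta xi : 'rV[R[i]]_n.+1) (X : 'rV[R[i]]_(n.+1 + n.+1)) : Prop :=
  exists (I : set R) (a : mchart M) (u : R -> 'rV[R]_m)
         (zt xt : R -> 'rV[R[i]]_n.+1),
    [/\ open I /\ I 0,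
        [/\ rsmooth_on I u, csmooth_on I zt & csmooth_on I xt],
        forall t, I t -> mdom a (u t) /\
                         normal_rep F (mpar a (u t)) (zt t) (xt t),
        [/\ mpar a (u 0) = p, zt 0 = zeta & xt 0 = xi] &
        X = cvderive (1 : R) (fun t => Phi (zt t) (xt t)) 0].

Definition austere n m (M : manifold R m) (F : M -> CP R n) : Prop :=
  exists phi : R,
  forall (p : M) (zeta xi : 'rV[R[i]]_n.+1), normal_rep F p zeta xi ->
    (forall X Y, tangent_PhiN F p zeta xi X -> tangent_PhiN F p zeta xi Y ->
       Omega (Phi zeta xi) X Y = 0) /\
    (forall X : 'M[R[i]]_(n + n, n.+1 + n.+1),
       (forall b, tangent_PhiN F p zeta xi (row b X)) ->
       complex.Im ((cos phi +i* sin phi) * Theta (Phi zeta xi) X) = 0).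

End Austere.

(* Main.v *)
Require Import Defs.
From mathcomp Require Import all_boot all_order all_algebra.
From mathcomp Require Import all_fingroup.
From mathcomp Require Import all_classical all_reals all_analysis.
From mathcomp Require Import complex ring lra.

(** Let T be the tangent space, in C^(n+1), of the cone over the complex
    submanifold M: it is spanned over C by a lift zeta and by the derivatives
    S_1, ..., S_k of a holomorphic lift.  As T is a complex subspace, being
    normal to M for the real metric is the same as being Hermitian orthogonal
    to T ([normal_rep_complex]).  Differentiating the orthogonality relations
    along a curve (zeta(t), xi(t)) of the normal bundle gives
      zeta' = c zeta + v S,   xi' . conj zeta = 0,   xi' . conj S = - conj v Q,
    where Q consists of the numbers xi . conj (d_i d_j sigma), for a holomorphic
    lift sigma.  So conj v |-> - conj v Q is the shape operator A in the
    direction xi: it is antilinear because sigma is holomorphic and symmetric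
    because mixed partial derivatives commute ([complex_normal_data]).  The map
    Phi sends such a velocity to (al + i be, conj al + i conj be) with
    al = a zeta' + r zeta and be = b xi' + s xi, for a = cosh mu,
    b = sinh mu / mu and some real r, s; hence al lies in T, and the component
    of be in T is - b A zeta' ([tangent_PhiN_form]).

    The Kaehler potential is f = 2 |z| |w| / |z . w|.  Since
    log f = (log |z|^2 + log |w|^2 - log |z . w|^2) / 2 up to a constant, the
    Hermitian form of Omega is f times
      (del log f)(X) conj ((del log f)(Y)) + (Fubini-Study terms in z and in w),
    where del is the (1,0)-part of d, see [OmegaE].  On the vectors above
    del log f takes real values and the Fubini-Study terms are symmetric in X
    and Y, because Q is symmetric; this is the classical reason why a conormal
    bundle is Lagrangian ([Omega_normal]).

    For Theta, regard C^(n+1) x C^(n+1) as the complexification of the real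
    vector space of the pairs (u, conj u).  All rows of the determinant defining
    Theta are images, under one complex linear map G, of such pairs or of the
    two halves (u, 0), (0, conj u) of one of them.  On the complexification of T
    the map G is a - i b A, on that of the orthogonal complement it is i.  The
    conjugate numbers det (a - i b A) and det (a + i b A) are equal, as A
    anticommutes with the complex structure of T, and the orthogonal complement
    has even real dimension; so det G is real ([det_graph_mx_conj]).  This is
    where complex submanifolds are austere.  Hence conj Theta = +- Theta with a
    sign that depends on n only ([det_Theta_mx_conj], [Theta_phase]), and the
    phase is 0 or pi / 2. *)

Set Implicit Arguments.
Unset Strict Implicit.
Unset Printing Implicit Defensive.

Import Order.TTheory GRing.Theory Num.Theory.
Import numFieldNormedType.Exports.

Local Open Scope classical_set_scope.
Local Open Scope ring_scope.
Local Open Scope complex_scope.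

(** * Differentiation in several real variables *)
Section Differentiable.
Variables (R : realType) (V : normedModType R).

Lemma near_eq_differentiable (f g : V -> R) x :
  (\near x, f x = g x) -> differentiable f x -> differentiable g x.
Proof.
move=> fg df; pose h := g - f.
have hz : \forall y \near x, h y = 0.
  by near=> y; rewrite /h fctE -(near fg y) ?subrr.
have hx : h x = 0 by exact: nbhs_singleton hz.
have -> : g = f + h by rewrite /h addrC subrK.
apply: differentiableD => //.
(* h vanishes near x, so that its differential at x is zero *)
have c0 : continuous (\0 : V -> R) by move=> y; exact: cst_continuous.
have e : h \o shift x = cst (h x) + (\0 : V -> R) +o_ (0 : V) id.
  apply/eqaddoP => _/posnumP[e]; rewrite near_simpl.
  have : \forall y \near (0 : V), h (y + x) = 0.
    move: hz; rewrite (near_shift 0 x) subr0.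
    by apply: filterS => y; rewrite /= ?subr0.
  apply: filterS => y hy; rewrite (_ : (_ - _) y = h (y + x) - (h x + 0)) //.
  by rewrite hy hx addr0 subrr normr0 mulr_ge0.
by apply/diff_locallyP; rewrite (diff_unique c0 e).
Unshelve. all: by end_near. Qed.

Lemma differentiable_rV m (f : V -> 'rV[R]_m) x :
  (forall j, differentiable (fun y => f y 0 j) x) -> differentiable f x.
Proof.
move=> df; have -> : f = \sum_j (fun y => f y 0 j *: delta_mx 0 j).
  by apply/funext => y; rewrite fct_sumE -row_sum_delta.
apply: differentiable_sum => j; exact: differentiableZl.
Qed.

Lemma derive_rV m (f : V -> 'rV[R]_m) x v j : differentiable f x ->
  'D_v f x 0 j = 'D_v (fun y => f y 0 j) x.
Proof. by move=> df; rewrite derive_mx ?mxE //; exact: diff_derivable. Qed.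

Lemma derive_comp_rV m (f : V -> 'rV[R]_m) (g : 'rV[R]_m -> R) x v :
  differentiable f x -> differentiable g (f x) ->
  'D_v (g \o f) x = 'D_('D_v f x) g (f x).
Proof.
move=> df dg; rewrite !deriveE //; last exact: differentiable_comp.
by rewrite diff_comp.
Qed.

Lemma derive_rV_sum m (g : 'rV[R]_m -> R) x v : differentiable g x ->
  'D_v g x = \sum_j v 0 j * 'D_(delta_mx 0 j) g x.
Proof.
move=> dg; rewrite deriveE // {1}[v]row_sum_delta linear_sum /=.
by apply: eq_bigr => j _; rewrite linearZ deriveE.
Qed.

End Differentiable.

Lemma Ck_subset (R : realType) (V : normedModType R) (U W : set V) k (f : V -> R) :
  W `<=` U -> Ck k U f -> Ck k W f.
Proof.
move=> WU; elim: k f => [|k IH] f /=; first by move=> cf x /WU; exact: cf.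
by move=> [df Df]; split=> [x /WU|v]; [exact: df|exact/IH/Df].
Qed.

Section SmoothOn.
Variables (R : realType) (V : normedModType R) (U : set V).
Hypothesis oU : open U.

Lemma Ck_eq k (f g : V -> R) :
  (forall x, U x -> f x = g x) -> Ck k U f -> Ck k U g.
Proof.
have nU (f1 g1 : V -> R) x : (forall x, U x -> f1 x = g1 x) -> U x -> \near x, f1 x = g1 x.
  move=> fg Ux; have : nbhs x U by exact: open_nbhs_nbhs.
  by apply: filterS.
elim: k f g => [|k IH] f g fg /=.
  move=> cf x Ux; have cfx : f @ x --> f x := cf x Ux.
  change (g @ x --> g x); rewrite -fg //.
  by apply: cvg_trans cfx; apply: near_eq_cvg; apply: nU => // y Uy; rewrite fg.
move=> [df Df]; split=> [x Ux|v].
  by apply: (near_eq_differentiable _ (df x Ux)); exact: nU.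
apply: IH (Df v) => x Ux; apply: near_eq_derive; exact: nU.
Qed.

Lemma CkW k (f : V -> R) : Ck k.+1 U f -> Ck k U f.
Proof.
elim: k f => [|k IH] f /=; first by move=> [df _] x /df /differentiable_continuous.
by move=> [df Df]; split=> // v; apply: IH; exact: Df.
Qed.

Lemma Ck_cst k (c : R) : Ck k U (cst c).
Proof.
elim: k c => [|k IH] c /=; first by move=> x _; exact: cst_continuous.
split=> [x _|v]; first exact: differentiable_cst.
by apply: (Ck_eq _ (IH 0)) => x _; rewrite derive_cst.
Qed.

Lemma Ck_add k (f g : V -> R) : Ck k U f -> Ck k U g -> Ck k U (f + g).
Proof.
elim: k f g => [|k IH] f g /=.
  by move=> cf cg x Ux; apply: continuousD; [exact: cf|exact: cg].
move=> [df Df] [dg Dg]; split=> [x Ux|v].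
  by apply: differentiableD; [exact: df|exact: dg].
apply: (Ck_eq _ (IH _ _ (Df v) (Dg v))) => x Ux.
by rewrite deriveD //; apply: diff_derivable; [exact: df|exact: dg].
Qed.

Lemma Ck_mul k (f g : V -> R) : Ck k U f -> Ck k U g -> Ck k U (f * g).
Proof.
elim: k f g => [|k IH] f g.
  by move=> /= cf cg x Ux; apply: continuousM; [exact: cf|exact: cg].
move=> Cf Cg; have [df Df] := Cf; have [dg Dg] := Cg; split=> [x Ux|v].
  by apply: differentiableM; [exact: df|exact: dg].
apply: (Ck_eq _ (Ck_add (IH _ _ (CkW Cf) (Dg v)) (IH _ _ (CkW Cg) (Df v)))).
move=> x Ux.
by rewrite deriveM //; apply: diff_derivable; [exact: df|exact: dg].
Qed.

Lemma Ck_sum k m (f : 'I_m -> V -> R) :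
  (forall j, Ck k U (f j)) -> Ck k U (\sum_j f j).
Proof.
move=> Cf; elim/big_rec: _ => [|j g _ Cg]; first exact: Ck_cst.
exact: Ck_add.
Qed.

(** By the chain rule, each derivative of g o f is a sum of products of a
    derivative of f and a function (D g) o f of the same shape, which is what
    makes an induction on the order work. *)
Lemma Ck_comp k m (W : set 'rV[R]_m) (f : V -> 'rV[R]_m) (g : 'rV[R]_m -> R) :
  rsmooth_on U f -> (forall x, U x -> W (f x)) -> Ck k W g -> Ck k U (g \o f).
Proof.
move=> sf fUW.
have df x : U x -> differentiable f x.
  by move=> Ux; apply: differentiable_rV => j; have [+ _] := sf j 1; exact.
elim: k g => [|k IH] g /=.
  move=> cg x Ux; apply: continuous_comp; last exact/cg/fUW.
  exact/differentiable_continuous/df.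
move=> [dg Dg]; split=> [x Ux|v].
  by apply: differentiable_comp; [exact: df|exact/dg/fUW].
apply: (@Ck_eq _ (\sum_j (fun y => 'D_v (fun y => f y 0 j) y) *
                         ('D_(delta_mx 0 j) g \o f))).
  move=> x Ux; rewrite derive_comp_rV; [|exact: df|exact/dg/fUW].
  rewrite derive_rV_sum; last exact/dg/fUW.
  by rewrite fct_sumE; apply: eq_bigr => j _; rewrite derive_rV //; exact: df.
apply: Ck_sum => j; apply: Ck_mul; last exact/IH/Dg.
by have [_ +] := sf j k.+1; exact.
Qed.

End SmoothOn.

Section Schwarz.
Variables (R : realType) (V : normedModType R).

Lemma is_derive_line (f : V -> R) x v (s : R) : differentiable f (x + s *: v) ->
  is_derive s (1 : R) (fun r : R => f (x + r *: v)) ('D_v f (x + s *: v)).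
Proof.
move=> df.
have dl : differentiable (fun r : R => x + r *: v) s.
  by apply: differentiableD; [exact: differentiable_cst|exact: differentiableZl].
have dc : differentiable (f \o (fun r : R => x + r *: v)) s.
  exact: differentiable_comp.
apply: DeriveDef; first exact: diff_derivable.
rewrite -[LHS]/('D_1 (f \o (fun r : R => x + r *: v)) s) deriveE // diff_comp //=.
rewrite [in RHS]deriveE //; congr ('d f _ _).
rewrite -deriveE // (_ : (fun r : R => _) = cst x + (fun r : R => r *: v)) //.
have d1 : differentiable (fun r : R => r *: v) s by exact: differentiableZl.
rewrite deriveD ?derive_cst ?add0r; [|exact: derivable_cst|exact: diff_derivable].
by have [_ e] := is_diff_scalel s v; rewrite deriveE // e scale1r.
Qed.

(** The mean value theorem, in the direction v for the difference of f along
    h w and then in the direction w for D_v f, evaluates the second difference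
    of f on a parallelogram. *)
Lemma MVT_square (f : V -> R) x v w h : 0 < h ->
  (forall s t, 0 <= s <= h -> 0 <= t <= h ->
     differentiable f (x + s *: v + t *: w) /\
     differentiable ('D_v f) (x + s *: v + t *: w)) ->
  exists s t, [/\ 0 <= s <= h, 0 <= t <= h &
    f (x + h *: v + h *: w) - f (x + h *: v) - f (x + h *: w) + f x =
    'D_w ('D_v f) (x + s *: v + t *: w) * h * h].
Proof.
move=> h0 df.
have hh : 0 <= h <= h by rewrite lexx ltW.
have z0 : (0 : R) <= (0 : R) <= h by rewrite lexx ltW.
have dvt t s : 0 <= s <= h -> 0 <= t <= h ->
    is_derive s (1 : R) (fun r : R => f (x + r *: v + t *: w)) ('D_v f (x + s *: v + t *: w)).
  move=> hs ht; have [d _] := df s t hs ht.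
  have -> : (fun r : R => f (x + r *: v + t *: w)) = (fun r : R => f (x + t *: w + r *: v)).
    by apply/funext => r; rewrite addrAC.
  by rewrite addrAC in d *; exact: is_derive_line.
pose phi s := f (x + s *: v + h *: w) - f (x + s *: v).
pose dphi s := 'D_v f (x + s *: v + h *: w) - 'D_v f (x + s *: v).
have dphiP s : 0 <= s <= h -> is_derive s (1 : R) phi (dphi s).
  move=> hs; apply: is_deriveB; first exact: dvt.
  have e r : x + r *: v + 0 *: w = x + r *: v by rewrite scale0r addr0.
  by have := dvt 0 s hs z0; under eq_fun do rewrite e; rewrite e.
have [s] : exists2 s, s \in `]0, h[ & phi h - phi 0 = dphi s * (h - 0).
  apply: (@MVT R phi dphi 0 h h0) => [s|].
    by rewrite in_itv /= => /andP[/ltW s0 /ltW s1]; apply: dphiP; rewrite s0.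
  apply: derivable_within_continuous => s; rewrite in_itv /= => hs.
  by have [] := dphiP s hs.
rewrite in_itv /= => /andP[/ltW s0 /ltW s1] e1.
have hs : 0 <= s <= h by rewrite s0.
pose psi t := 'D_v f (x + s *: v + t *: w).
have dpsi t : 0 <= t <= h -> is_derive t (1 : R) psi ('D_w ('D_v f) (x + s *: v + t *: w)).
  by move=> ht; have [_ d] := df s t hs ht; exact: is_derive_line.
have [t] : exists2 t, t \in `]0, h[ &
    psi h - psi 0 = 'D_w ('D_v f) (x + s *: v + t *: w) * (h - 0).
  apply: (@MVT R psi (fun t => 'D_w ('D_v f) (x + s *: v + t *: w)) 0 h h0) => [t|].
    by rewrite in_itv /= => /andP[/ltW t0 /ltW t1]; apply: dpsi; rewrite t0.
  apply: derivable_within_continuous => t; rewrite in_itv /= => ht.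
  by have [] := dpsi t ht.
rewrite in_itv /= => /andP[/ltW t0 /ltW t1] e2.
exists s, t; split => //; first by rewrite t0.
move: e1 e2; rewrite /phi /dphi /psi !subr0 !scale0r !addr0 => e1 e2.
by rewrite -e2 -e1; ring.
Qed.

(** Schwarz: the second difference of f on the parallelogram spanned by h v and
    h w is symmetric in v and w, so both mixed derivatives take equal values at
    points that tend to x with h; continuity concludes. *)
Lemma derive_comm (U : set V) (f : V -> R) x v w : open U -> U x -> Ck 2 U f ->
  'D_w ('D_v f) x = 'D_v ('D_w f) x.
Proof.
move=> oU Ux [df Df].
pose A := 'D_w ('D_v f); pose B := 'D_v ('D_w f).
have cA : {for x, continuous A} := (Df v).2 w x Ux.
have cB : {for x, continuous B} := (Df w).2 v x Ux.
pose inU v w h := forall s t, 0 <= s <= h -> 0 <= t <= h -> U (x + s *: v + t *: w).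
pose Delta v w h := f (x + h *: v + h *: w) - f (x + h *: v) - f (x + h *: w) + f x.
have mvt (a b : V) h : 0 < h -> inU a b h -> exists s t,
    [/\ 0 <= s <= h, 0 <= t <= h &
      Delta a b h = 'D_b ('D_a f) (x + s *: a + t *: b) * h * h].
  move=> h0 hU; apply: MVT_square => // s t hs ht; split; first exact/df/hU.
  by have [+ _] := Df a; apply; exact: hU.
have HA h : 0 < h -> inU v w h -> exists s t, [/\ 0 <= s <= h, 0 <= t <= h &
    Delta v w h = A (x + s *: v + t *: w) * h * h] := mvt v w h.
have HB h : 0 < h -> inU w v h -> exists s t, [/\ 0 <= s <= h, 0 <= t <= h &
    Delta w v h = B (x + s *: w + t *: v) * h * h] := mvt w v h.
change (A x = B x).
move: A B cA cB HA HB => A B cA cB HA HB {mvt df Df}.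
apply/eqP; rewrite -subr_eq0 -normr_le0; apply/ler_addgt0Pl => e e0.
rewrite addr0.
have e2 : 0 < e / 2 by rewrite divr_gt0.
have nA : \forall y \near x, `|A x - A y| < e / 2 by exact: (cvgrPdist_lt _ _).1 cA _ e2.
have nB : \forall y \near x, `|B x - B y| < e / 2 by exact: (cvgrPdist_lt _ _).1 cB _ e2.
have nU : \forall y \near x, U y by exact: open_nbhs_nbhs.
have : \forall y \near x, [/\ U y, `|A x - A y| < e / 2 & `|B x - B y| < e / 2].
  by apply: filterS3 nU nA nB => y; split.
move=> /nbhs_ballP [d /= d0 hd].
(* the summand 1 keeps the denominator positive when v = w = 0 *)
pose h := d / 2 / (`|v| + `|w| + 1).
have n0 : 0 < `|v| + `|w| + 1 by rewrite ltr_wpDl ?addr_ge0.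
have h0 : 0 < h by rewrite !divr_gt0.
have inb s t : 0 <= s <= h -> 0 <= t <= h -> ball x d (x + s *: v + t *: w).
  move=> /andP[s0 sh] /andP[t0 th].
  rewrite -ball_normE /ball_ /= -addrA opprD addNKr normrN.
  apply: (@le_lt_trans _ _ (h * `|v| + h * `|w|)).
    apply: le_trans (ler_normD _ _) _; rewrite !normrZ !ger0_norm //.
    by rewrite lerD // ler_wpM2r.
  apply: (@le_lt_trans _ _ (d / 2)); last by rewrite ltr_pdivrMr // ltr_pMr // ltr1n.
  rewrite -mulrDr /h mulrAC ler_pdivrMr // ler_wpM2l ?lerDl //.
  by rewrite divr_ge0 // ltW.
have [s [t [hs ht E1]]] := HA h h0 (fun s t hs ht =>
  let: And3 Uy _ _ := hd _ (inb s t hs ht) in Uy).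
have [t' [s' [ht' hs' E2]]] : exists s t, [/\ 0 <= s <= h, 0 <= t <= h &
    Delta w v h = B (x + s *: w + t *: v) * h * h].
  apply: HB => // t' s' ht' hs'; rewrite addrAC.
  by have [] := hd _ (inb s' t' hs' ht').
have hneq : h != 0 by rewrite gt_eqF.
have E3 : A (x + s *: v + t *: w) = B (x + s' *: v + t' *: w).
  apply: (mulIf hneq); apply: (mulIf hneq); rewrite -E1 (addrAC x (s' *: v)) -E2.
  by rewrite /Delta (addrAC x (h *: w)); ring.
have [_ B1 _] := hd _ (inb _ _ hs ht); have [_ _ B2] := hd _ (inb _ _ hs' ht').
rewrite (_ : _ - _ = (A x - A (x + s *: v + t *: w)) -
  (B x - B (x + s' *: v + t' *: w))); last by rewrite E3; ring.
by apply: le_trans (ler_normB _ _) _; rewrite [leRHS](splitr e) lerD // ltW.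
Qed.

End Schwarz.

(** * Complex valued functions of real variables *)
Section ComplexDerivative.
Variables (R : realType) (V : normedModType R).
Local Notation C := R[i].
Implicit Types (g h : V -> C) (x v : V).

Definition is_cderive x v g (l : C) :=
  is_derive x v (fun y => complex.Re (g y)) (complex.Re l) /\
  is_derive x v (fun y => complex.Im (g y)) (complex.Im l).

Lemma cderiveP x v g l : is_cderive x v g l -> cderive v g x = l.
Proof. by move=> [[_ e1] [_ e2]]; rewrite /cderive e1 e2; case: l {e1 e2}. Qed.

Lemma is_cderive_eq x v g l l' : is_cderive x v g l -> l = l' -> is_cderive x v g l'.
Proof. by move=> + <-. Qed.

Lemma near_is_cderive x v g h l :
  (\near x, g x = h x) -> is_cderive x v g l -> is_cderive x v h l.
Proof.
move=> gh [d1 d2]; split.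
  by apply: near_eq_is_derive d1; apply: filterS gh => y ->.
by apply: near_eq_is_derive d2; apply: filterS gh => y ->.
Qed.

Lemma near_cderive x v g h : (\near x, g x = h x) -> cderive v g x = cderive v h x.
Proof.
move=> gh; rewrite /cderive; congr (_ +i* _);
  by apply: near_eq_derive; apply: filterS gh => y ->.
Qed.

Lemma is_cderive_cst x v (c : C) : is_cderive x v (fun=> c) 0.
Proof. by split; exact: is_derive_cst. Qed.

Lemma is_cderive_real x v (f : V -> R) l :
  is_derive x v f l -> is_cderive x v (fun y => (f y)%:C) l%:C.
Proof. by move=> df; split => //=; exact: is_derive_cst. Qed.

Lemma ReD (a b : C) : complex.Re (a + b) = complex.Re a + complex.Re b.
Proof. by case: a b => ? ? []. Qed.
Lemma ImD (a b : C) : complex.Im (a + b) = complex.Im a + complex.Im b.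
Proof. by case: a b => ? ? []. Qed.
Lemma conjcD (a b : C) : conjc (a + b) = conjc a + conjc b.
Proof. exact: rmorphD. Qed.
Lemma conjcB (a b : C) : conjc (a - b) = conjc a - conjc b.
Proof. exact: rmorphB. Qed.
Lemma conjcM (a b : C) : conjc (a * b) = conjc a * conjc b.
Proof. exact: rmorphM. Qed.
Lemma ReB (a b : C) : complex.Re (a - b) = complex.Re a - complex.Re b.
Proof. by case: a b => ? ? []. Qed.
Lemma conjc_imag : conjc 'i%R = - 'i%R :> C.
Proof. exact: (conjCi C). Qed.
Lemma ReM (a b : C) : complex.Re (a * b) =
  complex.Re a * complex.Re b - complex.Im a * complex.Im b.
Proof. by case: a b => ? ? []. Qed.
Lemma ImM (a b : C) : complex.Im (a * b) =
  complex.Re a * complex.Im b + complex.Im a * complex.Re b.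
Proof. by case: a b => ? ? []. Qed.
Lemma Re_conjc (a : C) : complex.Re (conjc a) = complex.Re a.
Proof. by case: a. Qed.
Lemma Im_conjc (a : C) : complex.Im (conjc a) = - complex.Im a.
Proof. by case: a. Qed.

Lemma is_cderiveD x v g h l m : is_cderive x v g l -> is_cderive x v h m ->
  is_cderive x v (fun y => g y + h y) (l + m).
Proof.
move=> [g1 g2] [h1 h2]; split.
  rewrite ReD (_ : (fun y => _) = (fun y => complex.Re (g y)) + (fun y => complex.Re (h y))).
    exact: is_deriveD.
  by apply/funext => y; rewrite ReD.
rewrite ImD (_ : (fun y => _) = (fun y => complex.Im (g y)) + (fun y => complex.Im (h y))).
  exact: is_deriveD.
by apply/funext => y; rewrite ImD.
Qed.

Lemma is_cderive_sum n (I : 'I_n -> V -> C) x v (l : 'I_n -> C) :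
  (forall j, is_cderive x v (I j) (l j)) ->
  is_cderive x v (fun y => \sum_j I j y) (\sum_j l j).
Proof.
move=> dI; have E s : is_cderive x v (fun y => \sum_(j <- s) I j y) (\sum_(j <- s) l j).
  elim: s => [|j s IH].
    rewrite big_nil; apply: near_is_cderive (is_cderive_cst x v 0).
    by near=> y; rewrite big_nil.
  rewrite big_cons; apply: near_is_cderive (is_cderiveD (dI j) IH).
  by near=> y; rewrite big_cons.
exact: E.
Unshelve. all: by end_near. Qed.

Lemma is_cderive_conj x v g l : is_cderive x v g l ->
  is_cderive x v (fun y => conjc (g y)) (conjc l).
Proof.
move=> [g1 g2]; split.
  by rewrite Re_conjc; under eq_fun do rewrite Re_conjc.
by rewrite Im_conjc; under eq_fun do rewrite Im_conjc; exact: is_deriveN.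
Qed.

Lemma is_cderiveM x v g h l m : is_cderive x v g l -> is_cderive x v h m ->
  is_cderive x v (fun y => g y * h y) (l * h x + g x * m).
Proof.
move=> [g1 g2] [h1 h2]; split.
  rewrite (_ : (fun y => _) = (fun y => complex.Re (g y)) * (fun y => complex.Re (h y))
     - (fun y => complex.Im (g y)) * (fun y => complex.Im (h y))); last first.
    by apply/funext => y; rewrite ReM.
  apply: is_derive_eq (is_deriveB (is_deriveM g1 h1) (is_deriveM g2 h2)) _.
  by rewrite ReD !ReM /GRing.scale /=; ring.
rewrite (_ : (fun y => _) = (fun y => complex.Re (g y)) * (fun y => complex.Im (h y))
   + (fun y => complex.Im (g y)) * (fun y => complex.Re (h y))); last first.
  by apply/funext => y; rewrite ImM.
apply: is_derive_eq (is_deriveD (is_deriveM g1 h2) (is_deriveM g2 h1)) _.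
by rewrite ImD !ImM /GRing.scale /=; ring.
Qed.

Lemma is_cderiveZ x v g l (c : C) : is_cderive x v g l ->
  is_cderive x v (fun y => c * g y) (c * l).
Proof.
move=> dg; apply: is_cderive_eq (is_cderiveM (is_cderive_cst x v c) dg) _.
by rewrite mul0r add0r.
Qed.

Lemma is_cderiveN x v g l : is_cderive x v g l ->
  is_cderive x v (fun y => - g y) (- l).
Proof.
move=> dg; rewrite -mulN1r; apply: near_is_cderive (is_cderiveZ (-1) dg).
by near=> y; rewrite mulN1r.
Unshelve. all: by end_near. Qed.

Lemma is_cderiveB x v g h l m : is_cderive x v g l -> is_cderive x v h m ->
  is_cderive x v (fun y => g y - h y) (l - m).
Proof. by move=> dg dh; apply: is_cderiveD => //; exact: is_cderiveN. Qed.

Definition cdifferentiable g x :=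
  differentiable (fun y => complex.Re (g y)) x /\
  differentiable (fun y => complex.Im (g y)) x.

Lemma cdifferentiableP g x v : cdifferentiable g x ->
  is_cderive x v g (cderive v g x).
Proof. by move=> [d1 d2]; split; apply/derivableP/diff_derivable. Qed.

Lemma is_cderive_comp m (y : V -> 'rV[R]_m) (g : 'rV[R]_m -> C) x v :
  differentiable y x ->
  differentiable (fun z => complex.Re (g z)) (y x) ->
  differentiable (fun z => complex.Im (g z)) (y x) ->
  is_cderive x v (fun s => g (y s)) (cderive ('D_v y x) g (y x)).
Proof.
move=> dy d1 d2; split; apply: DeriveDef.
- exact/diff_derivable/(differentiable_comp dy d1).
- exact: (derive_comp_rV v dy d1).
- exact/diff_derivable/(differentiable_comp dy d2).
- exact: (derive_comp_rV v dy d2).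
Qed.

End ComplexDerivative.

Section ComplexSmooth.
Variables (R : realType) (V : normedModType R).
Local Notation C := R[i].

Lemma cderive_sum m (g : 'rV[R]_m -> C) x v : cdifferentiable g x ->
  cderive v g x = \sum_j (v 0 j)%:C * cderive (delta_mx 0 j) g x.
Proof.
move=> [d1 d2]; rewrite /cderive (derive_rV_sum v d1) (derive_rV_sum v d2).
elim/big_rec3: _ => // j a b c _ <-.
by apply/eqP; rewrite eq_complex /= !mul0r subr0 addr0 !eqxx.
Qed.

Definition csmooth (U : set V) (g : V -> C) :=
  smooth_on U (fun y => complex.Re (g y)) /\ smooth_on U (fun y => complex.Im (g y)).

Lemma csmooth_diff U g x : csmooth U g -> U x -> cdifferentiable g x.
Proof. by move=> [s1 s2] Ux; split; [have [+ _] := s1 1%N|have [+ _] := s2 1%N]; exact. Qed.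

Lemma csmooth_derive U g v : csmooth U g -> csmooth U (cderive v g).
Proof.
by move=> [s1 s2]; split=> k; [have [_ +] := s1 k.+1|have [_ +] := s2 k.+1]; exact.
Qed.

Lemma csmoothZ U g (c : C) : open U -> csmooth U g -> csmooth U (fun y => c * g y).
Proof.
move=> oU [s1 s2]; split=> k.
  rewrite (_ : (fun y => _) = cst (complex.Re c) * (fun y => complex.Re (g y)) +
    cst (- complex.Im c) * (fun y => complex.Im (g y))).
    by apply: Ck_add => //; apply: Ck_mul => //; exact: Ck_cst.
  by apply/funext => y; rewrite ReM -mulNr.
rewrite (_ : (fun y => _) = cst (complex.Re c) * (fun y => complex.Im (g y)) +
  cst (complex.Im c) * (fun y => complex.Re (g y))).
  by apply: Ck_add => //; apply: Ck_mul => //; exact: Ck_cst.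
by apply/funext => y; rewrite ImM.
Qed.

Lemma cderive_comm (U : set V) g x v w : open U -> U x -> csmooth U g ->
  cderive w (cderive v g) x = cderive v (cderive w g) x.
Proof.
move=> oU Ux [s1 s2].
exact: (f_equal2 (@Complex R) (derive_comm v w oU Ux (s1 2%N))
                              (derive_comm v w oU Ux (s2 2%N))).
Qed.

End ComplexSmooth.

Lemma csmooth_comp (R : realType) (V : normedModType R) (U : set V) m
    (W : set 'rV[R]_m) (f : V -> 'rV[R]_m) (g : 'rV[R]_m -> R[i]) :
  open U -> rsmooth_on U f -> (forall x, U x -> W (f x)) -> csmooth W g ->
  csmooth U (fun x => g (f x)).
Proof.
move=> oU sf fUW [s1 s2]; split=> k.
  exact: (Ck_comp oU sf fUW (s1 k)).
exact: (Ck_comp oU sf fUW (s2 k)).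
Qed.

(** * The Hermitian form of C^N and homogeneous coordinates *)
Section Hermitian.
Variable R : realType.
Local Notation C := R[i].

Lemma cdotE N (u v : 'rV[C]_N) : cdot u v = (u *m v^T) 0 0.
Proof. by rewrite mxE; apply: eq_bigr => j _; rewrite mxE. Qed.

Lemma cdotC N (u v : 'rV[C]_N) : cdot u v = cdot v u.
Proof. by apply: eq_bigr => j _; rewrite mulrC. Qed.

Lemma cdotDl N (u v w : 'rV[C]_N) : cdot (u + v) w = cdot u w + cdot v w.
Proof. by rewrite !cdotE mulmxDl mxE. Qed.

Lemma cdotZl N (a : C) (u v : 'rV[C]_N) : cdot (a *: u) v = a * cdot u v.
Proof. by rewrite !cdotE -scalemxAl mxE. Qed.

Lemma cdotDr N (u v w : 'rV[C]_N) : cdot u (v + w) = cdot u v + cdot u w.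
Proof. by rewrite cdotC cdotDl !(cdotC u). Qed.

Lemma cdotZr N (a : C) (u v : 'rV[C]_N) : cdot u (a *: v) = a * cdot u v.
Proof. by rewrite cdotC cdotZl cdotC. Qed.

Lemma cdot0l N (u : 'rV[C]_N) : cdot 0 u = 0.
Proof. by rewrite cdotE mul0mx mxE. Qed.

Lemma cconjD N (u v : 'rV[C]_N) : cconj (u + v) = cconj u + cconj v.
Proof. exact: map_mxD. Qed.

Lemma cconjB N (u v : 'rV[C]_N) : cconj (u - v) = cconj u - cconj v.
Proof. exact: map_mxB. Qed.

Lemma cconjZ N (a : C) (u : 'rV[C]_N) : cconj (a *: u) = conjc a *: cconj u.
Proof. exact: map_mxZ. Qed.

Lemma cconjK N : involutive (@cconj R N).
Proof. by move=> u; apply/rowP => j; rewrite !mxE conjcK. Qed.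

Lemma conjc_cdot N (u v : 'rV[C]_N) : conjc (cdot u v) = cdot (cconj u) (cconj v).
Proof. by rewrite rmorph_sum; apply: eq_bigr => j _; rewrite rmorphM !mxE. Qed.

Lemma cdot_self N (u : 'rV[C]_N) : exists2 r : R, cdot u (cconj u) = r%:C & 0 <= r.
Proof.
exists (\sum_j (complex.Re (u 0 j) ^+ 2 + complex.Im (u 0 j) ^+ 2)).
  rewrite rmorph_sum; apply: eq_bigr => j _; rewrite mxE.
  by case: (u 0 j) => a b; apply/eqP; rewrite eq_complex /=; apply/andP; split; apply/eqP; ring.
by apply: sumr_ge0 => j _; rewrite addr_ge0 ?sqr_ge0.
Qed.

Lemma cdot_self_eq0 N (u : 'rV[C]_N) : cdot u (cconj u) = 0 -> u = 0.
Proof.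
move=> u0; apply/rowP => j; rewrite mxE.
have h i : true -> 0 <= u 0 i * cconj u 0 i by rewrite mxE mulcJ_ge0.
have /(_ j isT) := (psumr_eq0P h u0).
by rewrite mxE -sqr_normc => /eqP; rewrite sqrf_eq0 normr_eq0 => /eqP.
Qed.

Lemma cnorm_sqr N (u : 'rV[C]_N) : ((cnorm u) ^+ 2)%:C = cdot u (cconj u).
Proof. by have [r e r0] := cdot_self u; rewrite /cnorm e /= sqr_sqrtr. Qed.

Lemma cnorm_gt0 N (u : 'rV[C]_N) : u != 0 -> 0 < cnorm u.
Proof.
move=> u0; rewrite lt_neqAle sqrtr_ge0 andbT eq_sym; apply: contra u0 => /eqP e.
by apply/eqP/cdot_self_eq0; rewrite -cnorm_sqr e expr0n.
Qed.

Lemma hproj_line n (a : C) (zeta : 'rV[C]_n.+1) : zeta != 0 -> hproj zeta (a *: zeta) = 0.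
Proof.
move=> z0; rewrite /hproj cdotZl mulfK ?subrr //.
by apply: contra z0 => /eqP /cdot_self_eq0 ->.
Qed.

Lemma cdot_hproj n (xi zeta eta : 'rV[C]_n.+1) : cdot xi (cconj zeta) = 0 ->
  cdot xi (cconj (hproj zeta eta)) = cdot xi (cconj eta).
Proof.
by move=> h; rewrite /hproj cconjB cdotDr -scaleN1r cconjZ !cdotZr h !mulr0 addr0.
Qed.

Lemma hcoord_line n (p : CP R n) z w : hcoord p z -> hcoord p w ->
  exists2 c : C, c != 0 & z = c *: w.
Proof.
move=> [z0 zp] [w0 wp]; have : z \in <[w]>%VS by rewrite -wp zp memv_line.
case/vlineP => c e; exists c => //; apply: contra z0 => /eqP c0.
by rewrite e c0 scale0r.
Qed.

Lemma hcoordZ n (p : CP R n) z (c : C) : c != 0 -> hcoord p z -> hcoord p (c *: z).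
Proof.
move=> c0 [z0 zp]; split; first by rewrite scaler_eq0 negb_or c0.
rewrite zp; apply/eqP; rewrite eqEsubv -!memvE memvZ ?memv_line // andbT.
by rewrite -{1}(scalerK c0 z) memvZ // memv_line.
Qed.

End Hermitian.

(** * Changing charts *)
Section Transition.
Variables (R : realType) (n m : nat) (M : manifold R m) (F : M -> CP R n).
Variables (U : set 'rV[R]_m) (x : 'rV[R]_m -> M).
Hypothesis xU : smooth_param U x.

Lemma open_overlap (T : topologicalType) (A B : set 'rV[R]_m) (y z : 'rV[R]_m -> T) :
  local_param A y -> local_param B z -> open (A `&` y @^-1` (z @` B)).
Proof.
move=> [oA _ Ay] [oB _ Bz]; apply/Ay; first by move=> u [].
rewrite (_ : y @` _ = (y @` A) `&` (z @` B)).
  by apply: openI; [apply/Ay|apply/Bz].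
apply/seteqP; split=> [_ [u [Au Bu] <-]|q [[u Au <-] Bu]]; last by exists u.
by split=> //; exists u.
Qed.

Lemma rsmooth_differentiable (V : normedModType R) (A : set V) (f : V -> 'rV[R]_m) u :
  rsmooth_on A f -> A u -> differentiable f u.
Proof. by move=> sf Au; apply: differentiable_rV => j; have [+ _] := sf j 1%N; exact. Qed.

Variables (W : set 'rV[R]_m) (sigma : 'rV[R]_m -> 'rV[R[i]]_n.+1).
Hypotheses (oW : open W) (WU : W `<=` U) (sW : csmooth_on W sigma).
Hypothesis hW : forall y, W y -> hcoord (F (x y)) (sigma y).

Lemma transition (a : mchart M) : exists (T : set 'rV[R]_m) (tau : 'rV[R]_m -> 'rV[R]_m),
  [/\ open T, rsmooth_on T tau, 
      forall u, T u -> U (tau u) /\ x (tau u) = mpar a u &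
      forall u y, mdom a u -> U y -> mpar a u = x y -> T u /\ tau u = y].
Proof.
have [px xa] := xU; have [_ [tau stau htau]] := xa a; have [oU injx _] := px.
exists (mdom a `&` (@mpar R m M a) @^-1` (x @` U)), tau; split=> //.
- exact: open_overlap (mlocal_param a) px.
- by move=> u [ua ux]; exact: htau.
- move=> u y ua Uy e; have xu : (x @` U) (mpar a u) by rewrite e; exists y.
  split=> //; have [Ut et] := htau u ua xu; apply: injx => //.
  by rewrite et e.
Qed.

Lemma cotransition (a : mchart M) u y : mdom a u -> U y -> mpar a u = x y ->
  exists (T : set 'rV[R]_m) (tau : 'rV[R]_m -> 'rV[R]_m),
  [/\ open T, T y, rsmooth_on T tau, tau y = u &
      forall z, T z -> [/\ U z, mdom a (tau z) & mpar a (tau z) = x z]].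
Proof.
move=> ua Uy e; have [px xa] := xU; have [[tau stau htau] _] := xa a.
have [_ inja _] := mlocal_param a.
have yT : (@mpar R m M a @` mdom a) (x y) by exists u.
exists (U `&` x @^-1` (@mpar R m M a @` mdom a)), tau; split=> //.
- exact: open_overlap px (mlocal_param a).
- by have [ta et] := htau y Uy yT; apply: inja => //; rewrite et e.
- by move=> z [Uz zT]; have [ta et] := htau z Uz zT.
Qed.

Lemma cvderive_comp (V : normedModType R) (tau : V -> 'rV[R]_m) (c : R[i]) u v :
  differentiable tau u -> W (tau u) ->
  cvderive v (fun u => c *: sigma (tau u)) u =
  c *: cvderive ('D_v tau u) sigma (tau u).
Proof.
move=> dt Wt; apply/rowP => j; rewrite !mxE; apply: cderiveP.
have [d1 d2] := csmooth_diff (sW j) Wt.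
have := is_cderiveZ c (is_cderive_comp v dt d1 d2).
by apply: near_is_cderive; near=> z; rewrite mxE.
Unshelve. all: by end_near. Qed.

(** Tangent vectors are defined by the charts of the atlas, whereas the
    holomorphic lift sigma lives on another parametrization x.  Composing sigma
    with the change of coordinates gives a lift in the chart; its derivatives
    are those of sigma up to the bijection A, the differential of that change of
    coordinates.  The factor c allows any value of the lift over the given
    point. *)
Lemma chart_lift (a : mchart M) u y (c : R[i]) :
  mdom a u -> W y -> mpar a u = x y -> c != 0 ->
  exists W' s (A : 'rV[R]_m -> 'rV[R]_m),
    [/\ local_lift (mdom a) (F \o @mpar R m M a) u W' s, s u = c *: sigma y,
        forall v, cvderive v s u = c *: cvderive (A v) sigma y,
        forall w, exists v, A v = w & A 0 = 0].
Proof.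
move=> ua Wy e c0; have Uy := WU Wy.
have [T [tau [oT stau htau tauE]]] := transition a.
have [T' [tau' [oT' Ty stau' tau'y htau']]] := cotransition ua Uy e.
have [Tu tu] := tauE u y ua Uy e.
pose W' := mdom a `&` (T `&` tau @^-1` W).
have dt z : T z -> differentiable tau z by exact: rsmooth_differentiable.
have oW' : open W'.
  apply: openI; first by have [] := mlocal_param a.
  rewrite openE => z [Tz Wz]; apply: filterI; first exact: open_nbhs_nbhs.
  by apply: (differentiable_continuous (dt z Tz)); exact: open_nbhs_nbhs.
exists W', (fun u => c *: sigma (tau u)), (fun v => 'D_v tau u); split.
- split=> //; first by split=> //; split=> //; rewrite /preimage /= tu.
  + by move=> z [].
  + move=> j.
    have E : (fun z => (c *: sigma (tau z)) 0 j) = (fun z => c * sigma (tau z) 0 j).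
      by apply/funext => z; rewrite mxE.
    change (csmooth W' (fun z => (c *: sigma (tau z)) 0 j)); rewrite E.
    apply: csmoothZ => //; apply: (csmooth_comp (W := W)) (sW j) => //.
    * move=> l k; apply: (Ck_subset (U := T)) => //; last exact: stau.
      by move=> z [_ []].
    * by move=> z [_ []].
  + move=> z [az [Tz Wz]]; apply: hcoordZ => //=.
    by have [_ <-] := htau z Tz; exact: hW.
- by rewrite tu.
- by move=> v; rewrite cvderive_comp ?tu //; exact: dt.
- move=> w; exists ('D_w tau' y).
  have dt' : differentiable tau' y := rsmooth_differentiable stau' Ty.
  have dtu : differentiable tau (tau' y) by rewrite tau'y; exact: dt.
  apply/rowP => j; rewrite derive_rV; last exact: dt.
  have dj : differentiable (fun z => tau z 0 j) (tau' y).
    by rewrite tau'y; have [+ _] := stau j 1%N; exact.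
  rewrite -{1}tau'y -(derive_comp_rV w dt' dj).
  have -> : 'D_w ((fun z => tau z 0 j) \o tau') y = 'D_w (fun z : 'rV[R]_m => z 0 j) y.
    apply: near_eq_derive; have : nbhs y T' by exact: open_nbhs_nbhs.
    apply: filterS => z Tz; have [Uz az ez] := htau' z Tz.
    by have [_ /= ->] := tauE _ _ az Uz ez.
  have di : differentiable (fun z : 'rV[R]_m => z) y by exact: ex_diff.
  by rewrite -(derive_rV w j di) derive_id.
- by rewrite derive0.
Unshelve. all: by end_near. Qed.

End Transition.

(** * Normal vectors of complex submanifolds *)
Section VectorDerivative.
Variables (R : realType) (V : normedModType R) (N : nat).
Local Notation C := R[i].
Implicit Types (f g : V -> 'rV[C]_N).

Definition is_cvderive x (v : V) f (l : 'rV[C]_N) :=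
  forall j, is_cderive x v (fun y => f y 0 j) (l 0 j).

Lemma cvderiveP x v f l : is_cvderive x v f l -> cvderive v f x = l.
Proof. by move=> df; apply/rowP => j; rewrite mxE; exact: cderiveP. Qed.

Lemma csmooth_on_derive U f x v : csmooth_on U f -> U x ->
  is_cvderive x v f (cvderive v f x).
Proof.
move=> sf Ux j; rewrite mxE; apply: cdifferentiableP.
exact: (csmooth_diff (sf j) Ux).
Qed.

Lemma is_cderive_cdot x v f g l m : is_cvderive x v f l -> is_cvderive x v g m ->
  is_cderive x v (fun y => cdot (f y) (cconj (g y)))
    (cdot l (cconj (g x)) + cdot (f x) (cconj m)).
Proof.
move=> df dg; rewrite /cdot -big_split /=.
apply: is_cderive_sum => j.
have := is_cderiveM (df j) (is_cderive_conj (dg j)).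
rewrite !mxE; apply: near_is_cderive.
by near=> y; rewrite mxE.
Unshelve. all: by end_near. Qed.

Lemma is_cvderive_conj x v f l : is_cvderive x v f l ->
  is_cvderive x v (fun y => cconj (f y)) (cconj l).
Proof.
move=> h j; have := is_cderive_conj (h j); rewrite mxE.
by apply: near_is_cderive; near=> y; rewrite mxE.
Unshelve. all: by end_near. Qed.

Lemma is_cvderiveB x v f g l m : is_cvderive x v f l -> is_cvderive x v g m ->
  is_cvderive x v (fun y => f y - g y) (l - m).
Proof.
move=> df dg j; have := is_cderiveB (df j) (dg j); rewrite !mxE.
by apply: near_is_cderive; near=> y; rewrite !mxE.
Unshelve. all: by end_near. Qed.

Lemma is_cvderiveZ x v (c : V -> C) f b l : is_cderive x v c b -> is_cvderive x v f l ->
  is_cvderive x v (fun y => c y *: f y) (b *: f x + c x *: l).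
Proof.
move=> dc df j; have := is_cderiveM dc (df j); rewrite !mxE.
by apply: near_is_cderive; near=> y; rewrite !mxE.
Unshelve. all: by end_near. Qed.

End VectorDerivative.

Lemma is_cvderive_row_mx (R : realType) (V : normedModType R) (x v : V) n p
    (A : V -> 'rV[R[i]]_n) (B : V -> 'rV[R[i]]_p) dA dB :
  is_cvderive x v A dA -> is_cvderive x v B dB ->
  is_cvderive x v (fun y => row_mx (A y) (B y)) (row_mx dA dB).
Proof.
move=> hA hB j; case: (split_ordP j) => l ->.
  rewrite row_mxEl; apply: near_is_cderive (hA l).
  by near=> y; rewrite row_mxEl.
rewrite row_mxEr; apply: near_is_cderive (hB l).
by near=> y; rewrite row_mxEr.
Unshelve. all: by end_near. Qed.

Section NormalSpace.
Variables (R : realType) (n m : nat) (M : manifold R m) (F : M -> CP R n).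
Variables (U : set 'rV[R]_m) (x : 'rV[R]_m -> M).
Hypothesis xU : smooth_param U x.
Variables (W : set 'rV[R]_m) (sigma : 'rV[R]_m -> 'rV[R[i]]_n.+1).
Hypotheses (oW : open W) (WU : W `<=` U) (sW : csmooth_on W sigma).
Hypothesis hW : forall y, W y -> hcoord (F (x y)) (sigma y).

Lemma normal_rep_tangent p zeta xi y c v :
  p = x y -> W y -> normal_rep F p zeta xi -> c != 0 -> zeta = c *: sigma y ->
  complex.Re (cdot xi (cconj (c *: cvderive v sigma y))) = 0.
Proof.
move=> py Wy [hz xz xT] c0 ez.
have [a [u ua up]] := mcover p.
have epy : mpar a u = x y by rewrite up.
have [W' [s [A [ls su dA Asurj _]]]] := chart_lift xU oW WU sW hW ua Wy epy c0.
have [w <-] := Asurj v.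
have /xT : tangent_rep F p zeta (hproj zeta (cvderive w s u)).
  by exists a, u, w, W', s; rewrite ez.
rewrite /fubini_study (cdot_hproj _ xz) -dA => /eqP.
rewrite mulf_eq0 invr_eq0 sqrf_eq0 => /orP[/eqP //|].
by rewrite gt_eqF // cnorm_gt0 //; have [] := hz.
Qed.

Hypothesis hJ : forall y, W y -> forall v, exists w,
  cvderive w sigma y = 'i *: cvderive v sigma y.

(** Orthogonality for the real metric to a complex subspace is Hermitian
    orthogonality: testing against v and against i v kills the real and the
    imaginary part. *)
Lemma normal_rep_complex p zeta xi y :
  p = x y -> W y -> normal_rep F p zeta xi ->
  exists2 c, c != 0 &
    [/\ zeta = c *: sigma y, cdot xi (cconj (sigma y)) = 0 &
        forall v, cdot xi (cconj (cvderive v sigma y)) = 0].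
Proof.
move=> py Wy nr; have [hz xz _] := nr.
have hs : hcoord (F p) (sigma y) by rewrite py; exact: hW.
have [c c0 ez] := hcoord_line hz hs; exists c => //.
have cc0 : conjc c != 0 by rewrite conjc_eq0.
split=> //.
  by move: xz; rewrite ez cconjZ cdotZr => /eqP; rewrite mulf_eq0 (negPf cc0) => /eqP.
move=> v; have := normal_rep_tangent v py Wy nr c0 ez.
have [w ew] := hJ Wy v; have := normal_rep_tangent w py Wy nr c0 ez.
rewrite ew scalerA mulrC -scalerA cconjZ cdotZr.
rewrite [cconj (c *: _)]cconjZ cdotZr.
set t := conjc c * _ => e1 e2.
have t0 : t = 0.
  move: e1 e2; case: t => a b /= e1 e2; apply/eqP; rewrite eq_complex /= e2 eqxx.
  by move: e1; rewrite mul0r sub0r mulN1r opprK => ->; rewrite eqxx.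
by move/eqP: t0; rewrite mulf_eq0 (negPf cc0) => /eqP.
Qed.

(** A curve in the normal bundle, given in some chart, is rewritten in the
    coordinates x, in which the lift is holomorphic. *)
Lemma normal_curve (I : set R) (a : mchart M) (u : R -> 'rV[R]_m)
    (zt xt : R -> 'rV[R[i]]_n.+1) y0 :
  open I -> I 0 -> rsmooth_on I u ->
  (forall t, I t -> mdom a (u t) /\ normal_rep F (mpar a (u t)) (zt t) (xt t)) ->
  W y0 -> mpar a (u 0) = x y0 ->
  exists y : R -> 'rV[R]_m, [/\ differentiable y 0, y 0 = y0 &
    \forall t \near 0, W (y t) /\ normal_rep F (x (y t)) (zt t) (xt t)].
Proof.
move=> oI I0 su hI Wy0 e0.
have [T [tau [oT stau htau tauE]]] := transition xU a.
have [u0a _] := hI 0 I0; have [Tu0 tu0] := tauE _ _ u0a (WU Wy0) e0.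
have du : differentiable u 0 := rsmooth_differentiable su I0.
have dtau : differentiable tau (u 0) := rsmooth_differentiable stau Tu0.
have dy : differentiable (tau \o u) 0 by exact: differentiable_comp.
exists (tau \o u); split=> //.
have nI : \forall t \near (0 : R), I t by exact: open_nbhs_nbhs.
have nT : \forall t \near (0 : R), T (u t).
  by apply: (differentiable_continuous du); exact: open_nbhs_nbhs.
have nW : \forall t \near (0 : R), W (tau (u t)).
  by apply: (differentiable_continuous dy); apply: open_nbhs_nbhs; rewrite /= tu0.
apply: filterS3 nI nT nW => t It Tt Wt; split=> //=.
by have [_ ->] := htau _ Tt; have [] := hI t It.
Qed.

End NormalSpace.

Section ComplexCoordinates.
Variables (R : realType) (k N : nat).
Local Notation C := R[i].

Lemma ofCK : cancel (@ofC R k) (@toC R k).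
Proof.
by move=> z; apply/rowP => j; rewrite mxE row_mxEl row_mxEr !mxE; case: (z 0 j).
Qed.

Lemma d_dzbar_eq0 (g : 'rV[R]_(k + k) -> C) y a : d_dzbar a g y = 0 ->
  cderive (delta_mx 0 (rshift k a)) g y = 'i * cderive (delta_mx 0 (lshift k a)) g y.
Proof.
rewrite /d_dzbar => /eqP; rewrite mulf_eq0 invr_eq0 pnatr_eq0 /= addrC addr_eq0.
set r := cderive _ g y => /eqP e.
have -> : r = - ('i * ('i * r)) by rewrite mulrA -expr2 sqrCi mulN1r opprK.
by rewrite e mulrN opprK.
Qed.

Lemma holomorphic_cderive (g : 'rV[R]_(k + k) -> C) y : cdifferentiable g y ->
  (forall a, d_dzbar a g y = 0) -> forall v,
  cderive v g y = \sum_a toC v 0 a * cderive (delta_mx 0 (lshift k a)) g y.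
Proof.
move=> dg hg v; rewrite (cderive_sum _ dg) big_split_ord /= -big_split /=.
apply: eq_bigr => a _; rewrite d_dzbar_eq0 // mxE mulrA -mulrDl; congr (_ * _).
by rewrite [RHS]complexE /= [_ * 'i]mulrC.
Qed.

End ComplexCoordinates.

(** The rows of S are the derivatives of a holomorphic lift and Q is the second
    fundamental form in the direction xi.  Holomorphy enters twice: it makes the
    tangent spaces complex, and it makes the derivative of conj S along the curve
    linear in conj v.  The symmetry of Q is that of second derivatives, and the
    freeness of the rows of col_mx zeta S is the immersion property. *)
Lemma complex_normal_data (R : realType) (n k : nat) (M : manifold R (k + k))
    (F : M -> CP R n) (p : M) (zeta xi : 'rV[R[i]]_n.+1) :
  complex_submanifold F -> normal_rep F p zeta xi ->
  exists (S : 'M[R[i]]_(k, n.+1)) (Q : 'M[R[i]]_k),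
  [/\ Q^T = Q, row_free (col_mx zeta S),
      forall j, cdot xi (cconj (row j S)) = 0 &
      forall (I : set R) (a : mchart M) (u : R -> 'rV[R]_(k + k))
         (zt xt : R -> 'rV[R[i]]_n.+1),
        open I -> I 0 -> rsmooth_on I u -> csmooth_on I zt -> csmooth_on I xt ->
        (forall t, I t -> mdom a (u t) /\
                          normal_rep F (mpar a (u t)) (zt t) (xt t)) ->
        mpar a (u 0) = p -> zt 0 = zeta -> xt 0 = xi ->
        exists (c : R[i]) (v : 'rV[R[i]]_k),
        [/\ cvderive (1 : R) zt 0 = c *: zeta + v *m S,
            cdot (cvderive (1 : R) xt 0) (cconj zeta) = 0 &
            forall j, cdot (cvderive (1 : R) xt 0) (cconj (row j S)) =
                      - (cconj v *m Q) 0 j]].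
Proof.
move=> [[_ imm] cs] nr.
have [U [x [xU [y0 Uy0 ey0] hol]]] := cs p.
have [W [sigma [[oW Wy0 WU sW hW] [_ hbar]]]] := hol _ Uy0.
pose e (j : 'I_k) : 'rV[R]_(k + k) := delta_mx 0 (lshift k j).
pose S0 : 'M[R[i]]_(k, n.+1) := \matrix_(j, l) cderive (e j) (fun y => sigma y 0 l) y0.
have rowS0 j : row j S0 = cvderive (e j) sigma y0.
  by apply/rowP => l; rewrite !mxE.
have dsig y v : W y ->
    cvderive v sigma y = \sum_j toC v 0 j *: cvderive (e j) sigma y.
  move=> Wy; apply/rowP => l; rewrite !mxE summxE.
  rewrite (holomorphic_cderive (csmooth_diff (sW l) Wy)); last first.
    by move=> b; exact: hbar.
  by apply: eq_bigr => j _; rewrite !mxE.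
have hJ y : W y -> forall v, exists w,
    cvderive w sigma y = 'i *: cvderive v sigma y.
  move=> Wy v; exists (ofC ('i *: toC v)); rewrite !dsig // ofCK scaler_sumr.
  by apply: eq_bigr => j _; rewrite mxE scalerA.
have ep : p = x y0 by [].
have [c c0 [ez xs xd]] := normal_rep_complex xU oW WU sW hW hJ ep Wy0 nr.
have [hz xz _] := nr.
pose H i j : 'rV[R[i]]_n.+1 :=
  \row_l cderive (e i) (cderive (e j) (fun y => sigma y 0 l)) y0.
have Hsym i j : H i j = H j i.
  apply/rowP => l; rewrite [LHS]mxE [RHS]mxE.
  exact: (cderive_comm (e j) (e i) oW Wy0 (sW l)).
pose Q : 'M[R[i]]_k := \matrix_(i, j) (conjc c * cdot xi (cconj (H i j))).
exists (c *: S0), Q; split.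
- by apply/matrixP => i j; rewrite !mxE Hsym.
- apply: inj_row_free => v; rewrite -[v]hsubmxK mul_row_col.
  move: (lsubmx v) (rsubmx v) => v0 v1.
  rewrite [v0]mx11_scalar mul_scalar_mx -scalemxAr => e0.
  have dv : cvderive (ofC v1) sigma y0 = v1 *m S0.
    by rewrite dsig // ofCK mulmx_sum_row; apply: eq_bigr => j _; rewrite rowS0.
  have dv' : cvderive (ofC v1) sigma y0 = - v0 0 0 *: sigma y0.
    rewrite dv; apply: (scalerI c0); rewrite scalerA mulrC -scalerA -ez scaleNr.
    by apply/eqP; rewrite -addr_eq0 addrC e0.
  have [a [u ua up]] := mcover p.
  have epu : mpar a u = x y0 by rewrite up.
  have [W' [s [A [ls su dA Asurj A0]]]] :=
    chart_lift xU oW WU sW hW ua Wy0 epu (oner_neq0 _).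
  have s0 : sigma y0 != 0 by have [] := hW _ Wy0.
  have [w ew] := Asurj (ofC v1).
  have w0 : w = 0.
    apply: (imm _ _ _ _ ua ls); rewrite su dA ew !scale1r dv'.
    exact: hproj_line.
  have v10 : v1 = 0.
    by rewrite -[v1]ofCK -ew w0 A0; apply/rowP => j; rewrite !mxE.
  move/eqP: e0; rewrite v10 mul0mx scaler0 addr0 scaler_eq0.
  by have [/negPf -> _] := hz; rewrite orbF => /eqP ->; rewrite raddf0 row_mx0.
- by move=> j; rewrite linearZ /= rowS0 cconjZ cdotZr xd mulr0.
move=> I a u zt xt oI I0 su szt sxt hI u0 z0 x0.
have u0' : mpar a (u 0) = x y0 by rewrite u0.
have [y [dy y00 hy]] := normal_curve xU oW WU oI I0 su hI Wy0 u0'.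
have Wy00 : W (y 0) by rewrite y00.
pose v := 'D_1 y 0.
have dzt := csmooth_on_derive (1 : R) szt I0.
have dxt := csmooth_on_derive (1 : R) sxt I0.
have dst : is_cvderive 0 (1 : R) (fun t => sigma (y t)) (cvderive v sigma y0).
  move=> l; rewrite mxE -y00.
  have [d1 d2] := csmooth_diff (sW l) Wy00; exact: is_cderive_comp.
have nc : \forall t \near (0 : R), exists2 c, c != 0 &
    [/\ zt t = c *: sigma (y t), cdot (xt t) (cconj (sigma (y t))) = 0 &
        forall v, cdot (xt t) (cconj (cvderive v sigma (y t))) = 0].
  apply: filterS hy => t [Wt nt].
  exact: (normal_rep_complex xU oW WU sW hW hJ erefl Wt nt).
set zeta' := cvderive _ zt 0; set xi' := cvderive _ xt 0.
have [l sl] : exists l, sigma y0 0 l != 0.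
  by apply/rV0Pn; have [] := hW _ Wy0.
(* zeta(t) and sigma(y(t)) are proportional: differentiate the vanishing 2x2 minors *)
have E j : zeta' 0 j * sigma y0 0 l + zeta 0 j * cvderive v sigma y0 0 l =
           zeta' 0 l * sigma y0 0 j + zeta 0 l * cvderive v sigma y0 0 j.
  have := cderiveP (is_cderiveM (dzt j) (dst l)).
  have := cderiveP (is_cderiveM (dzt l) (dst j)).
  rewrite y00 z0 => <- <-; apply: near_cderive.
  by apply: filterS nc => t [ct _ [-> _ _]]; rewrite !mxE; ring.
have xs' : cdot xi' (cconj (sigma y0)) = 0.
  have := cderiveP (is_cderive_cdot dxt dst); rewrite y00 x0 xd addr0 => <-.
  rewrite (@near_cderive _ _ _ _ _ (fun=> 0)); first exact: cderiveP (is_cderive_cst _ _ _).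
  by apply: filterS nc => t [ct _ []].
exists ((zeta' 0 l - c * cvderive v sigma y0 0 l) / (c * sigma y0 0 l)), (toC v); split.
- apply/rowP => j; have := E j; rewrite ez -scalemxAr.
  have -> : toC v *m S0 = cvderive v sigma y0.
    by rewrite dsig // mulmx_sum_row; apply: eq_bigr => i _; rewrite rowS0.
  move: (cvderive v sigma y0) (sigma y0) sl => ds s sl; rewrite !mxE => Ej.
  apply: (mulIf sl); move: Ej => /(canRL (addrK _)) ->.
  by field; rewrite sl c0.
- by rewrite ez cconjZ cdotZr xs' mulr0.
move=> j; rewrite linearZ /= rowS0 cconjZ cdotZr.
have dHt : is_cvderive 0 (1 : R) (fun t => cvderive (e j) sigma (y t))
    (\sum_i toC v 0 i *: H i j).
  move=> i; rewrite summxE.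
  have sg := csmooth_derive (e j) (sW i).
  have [d1 d2] := csmooth_diff sg Wy00.
  have := is_cderive_comp (1 : R) dy d1 d2; rewrite -/v y00.
  rewrite (holomorphic_cderive (csmooth_diff sg Wy0)); last first.
    move=> b; rewrite /d_dzbar (cderive_comm (e j) (delta_mx 0 (lshift k b)) oW Wy0 (sW i)).
    rewrite (cderive_comm (e j) (delta_mx 0 (rshift k b)) oW Wy0 (sW i)).
    have -> : cderive (e j) (cderive (delta_mx 0 (rshift k b)) (fun y => sigma y 0 i)) y0 =
        'i * cderive (e j) (cderive (delta_mx 0 (lshift k b)) (fun y => sigma y 0 i)) y0.
      have sb := csmooth_derive (delta_mx 0 (lshift k b)) (sW i).
      have := cdifferentiableP (e j) (csmooth_diff sb Wy0).
      move=> /(is_cderiveZ 'i)%R /cderiveP <-; apply: near_cderive.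
      have : nbhs y0 W by exact: open_nbhs_nbhs.
      by apply: filterS => z Wz; apply: d_dzbar_eq0; exact: hbar.
    by rewrite mulrA -expr2 sqrCi mulN1r subrr mulr0.
  rewrite (_ : \sum_(l < k) _ = \sum_l (toC v 0 l *: H l j) 0 i); last first.
    by apply: eq_bigr => b _; rewrite !mxE.
  by apply: near_is_cderive; near=> t; rewrite mxE.
have := cderiveP (is_cderive_cdot dxt dHt).
rewrite (@near_cderive _ _ _ _ _ (fun=> 0)); last first.
  by apply: filterS nc => t [ct _ []].
rewrite (cderiveP (is_cderive_cst _ _ _)) y00 x0 => /esym/eqP.
rewrite addr_eq0 => /eqP ->; rewrite mulrN mxE; congr (- _).
rewrite /cconj raddf_sum cdotC /cdot; under eq_bigr do rewrite summxE mulr_suml.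
rewrite exchange_big /= mulr_sumr; apply: eq_bigr => i _.
rewrite !mxE cdotC /cdot !mulr_sumr; apply: eq_bigr => b _.
by rewrite !mxE rmorphM; ring.
Unshelve. all: by end_near. Qed.

(** * The velocity of Phi along a curve *)
Section Hyperbolic.
Variable R : realType.

Lemma is_derive_expRN (x : R) : is_derive x 1 (fun y : R => expR (- y)) (- expR (- x)).
Proof.
apply: is_derive_eq (is_derive1_comp (is_derive_expR (- x)) (is_deriveNid x 1)) _.
by rewrite mulrN1.
Qed.

Lemma is_derive_cosh (x : R) : is_derive x 1 (@cosh R) (sinh x).
Proof.
rewrite (_ : @cosh R = (2^-1) *: ((@expR R) + (fun y => expR (- y)))).
  apply: is_derive_eq (is_deriveZ _ (is_deriveD (is_derive_expR x) (is_derive_expRN x))) _.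
  by rewrite /sinh /GRing.scale /= mulrC.
by apply/funext => y; rewrite /cosh mulrC.
Qed.

Lemma is_derive_sinh (x : R) : is_derive x 1 (@sinh R) (cosh x).
Proof.
rewrite (_ : @sinh R = (2^-1) *: ((@expR R) - (fun y => expR (- y)))).
  apply: is_derive_eq (is_deriveZ _ (is_deriveB (is_derive_expR x) (is_derive_expRN x))) _.
  by rewrite /cosh /GRing.scale /= opprK mulrC.
by apply/funext => y; rewrite /sinh mulrC.
Qed.

Lemma cosh0 : cosh (0 : R) = 1.
Proof. by rewrite /cosh oppr0 expR0 -mulr2n divff. Qed.

Lemma sinh0 : sinh (0 : R) = 0.
Proof. by rewrite /sinh oppr0 expR0 subrr mul0r. Qed.

Lemma cosh_gt0 (x : R) : 0 < cosh x.
Proof. by rewrite /cosh divr_gt0 // addr_gt0 // expR_gt0. Qed.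

Lemma cosh_sinh_sqr (x : R) : cosh x ^+ 2 - sinh x ^+ 2 = 1.
Proof.
rewrite /cosh /sinh; have := expRxMexpNx_1 x.
by move: (expR x) (expR (- x)) => a b ab; field: ab.
Qed.

Lemma cosh_le (x : R) : 0 <= x <= 1 -> cosh x <= expR 1.
Proof.
move=> /andP[x0 x1]; rewrite /cosh ler_pdivrMr // mulr_natr mulr2n lerD // ler_expR //.
by rewrite (le_trans _ ler01) // oppr_le0.
Qed.

Lemma MVT0 (f df : R -> R) (x : R) :
  (forall y : R, is_derive y (1 : R) f (df y)) -> 0 < x ->
  exists2 c, 0 < c < x & f x - f 0 = df c * x.
Proof.
move=> dfP x0; have [|c] := MVT x0 (fun y _ => dfP y).
  by apply: derivable_within_continuous => y _; have [] := dfP y.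
by rewrite in_itv subr0; exists c.
Qed.

Lemma cosh_quadratic (x : R) : 0 <= x <= 1 -> `|cosh x - 1| <= expR 1 * x ^+ 2.
Proof.
move=> /andP[]; rewrite le_eqVlt => /predU1P[<- _|x0 x1].
  by rewrite cosh0 subrr normr0 expr0n mulr0.
have [c /andP[c0 cx]] := MVT0 is_derive_cosh x0; rewrite cosh0 => ->.
have [d /andP[d0 dc]] := MVT0 is_derive_sinh c0; rewrite sinh0 subr0 => ->.
have d1 : 0 <= d <= 1 by rewrite (ltW d0) (le_trans (ltW dc)) // (le_trans (ltW cx)).
have cd0 : 0 <= cosh d by rewrite ltW ?cosh_gt0.
rewrite -mulrA ger0_norm; last by rewrite !mulr_ge0 // ltW.
apply: ler_pM => //; [by rewrite mulr_ge0 ?ltW|exact: cosh_le|].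
by rewrite expr2 ler_pM2r // ltW.
Qed.

Lemma sinhc_quadratic (x : R) : 0 <= x <= 1 -> `|sinhc x - 1| <= expR 1 * x ^+ 2.
Proof.
move=> /andP[]; rewrite /sinhc le_eqVlt => /predU1P[<- _|x0 x1].
  by rewrite eqxx subrr normr0 expr0n mulr0.
rewrite gt_eqF //.
have [c /andP[c0 cx]] := MVT0 is_derive_sinh x0; rewrite sinh0 subr0 => ->.
rewrite mulfK ?gt_eqF //.
have c1 : 0 <= c <= 1 by rewrite (ltW c0) (le_trans (ltW cx)).
apply: le_trans (cosh_quadratic c1) _.
by rewrite ler_pM2l ?expR_gt0 // ler_pXn2r ?nnegrE ?ltW.
Qed.

(** Used with s = mu^2 at a point where xi = 0: there mu = |xi| / |zeta| need not
    be differentiable, but mu^2 is, with zero derivative, and cosh mu and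
    sinh mu / mu differ from 1 by O(mu^2). *)
Lemma is_derive_quadratic (h s : R -> R) (K : R) :
  is_derive (0 : R) (1 : R) s 0 -> s 0 = 0 ->
  (\forall t \near (0 : R), `|h t - h 0| <= K * s t) -> is_derive (0 : R) (1 : R) h 0.
Proof.
move=> [ds s'0] s0 hs.
have L : (fun t => t^-1 *: ((s \o shift 0) (t *: (1 : R)) - s 0)) @ 0^'
    --> ('D_1 s 0 : R) by exact: ds.
have K0 : (fun t : R => K *: (t^-1 *: ((s \o shift 0) (t *: (1 : R)) - s 0))) @ 0^'
    --> (K *: 'D_1 s 0 : R) by apply: cvgZ; [exact: cvg_cst|exact: L].
rewrite s'0 scaler0 in K0.
have c0 : (fun t => t^-1 *: ((h \o shift 0) (t *: (1 : R)) - h 0)) @ 0^' --> (0 : R).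
  apply/cvgr0Pnorm_lt => e e0.
  have n0 := (cvgr0Pnorm_lt _).1 K0 e e0.
  have hs' : \forall t \near (0 : R)^', `|h t - h 0| <= K * s t by exact: cvg_within hs.
  apply: filterS2 hs' (n0 _) => t ht; apply: le_lt_trans.
  rewrite /= addr0 s0 subr0 /GRing.scale /= mulr1 !normrM mulrCA.
  rewrite ler_wpM2l // -normrM (le_trans ht) // ler_norm //.
apply: DeriveDef; first by apply/cvg_ex; exists 0.
exact: cvg_lim c0.
Qed.

End Hyperbolic.

Lemma is_deriveV_ex (R : realType) (x : R) (f : R -> R) (df : R) :
  is_derive x (1 : R) f df -> f x != 0 ->
  exists r, is_derive x (1 : R) (fun t => (f t)^-1) r.
Proof.
move=> [h _] f0; eexists; apply: DeriveDef; last by [].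
exact: derivableV f0 h.
Qed.

Lemma is_derive_sinhc (R : realType) (x : R) : 0 < x ->
  exists r, is_derive x (1 : R) (@sinhc R) r.
Proof.
move=> x0; have [r hr] := is_deriveV_ex (is_derive_id x (1 : R)) (lt0r_neq0 x0).
eexists; apply: near_eq_is_derive (is_deriveM (is_derive_sinh x) hr).
near=> y; rewrite /sinhc gt_eqF //; near: y; exact: lt_nbhsr.
Unshelve. all: by end_near. Qed.

Section Velocity.
Variables (R : realType) (n : nat).
Local Notation C := R[i].
Variables (zt xt : R -> 'rV[C]_n.+1) (dz dx : 'rV[C]_n.+1).
Hypotheses (zt0 : zt 0 != 0).
Hypotheses (dzt : is_cvderive 0 (1 : R) zt dz) (dxt : is_cvderive 0 (1 : R) xt dx).

Lemma is_derive_cnorm_sqr (f : R -> 'rV[C]_n.+1) df :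
  is_cvderive 0 (1 : R) f df ->
  is_derive (0 : R) (1 : R) (fun t => complex.Re (cdot (f t) (cconj (f t))))
    (complex.Re (cdot df (cconj (f 0)) + cdot (f 0) (cconj df))).
Proof. by move=> h; have [] := is_cderive_cdot h h. Qed.

Lemma is_derive_cnorm (f : R -> 'rV[C]_n.+1) df :
  is_cvderive 0 (1 : R) f df -> f 0 != 0 ->
  exists r, is_derive (0 : R) (1 : R) (fun t => cnorm (f t)) r.
Proof.
move=> h f0; have dP := is_derive_cnorm_sqr h.
have P0 : 0 < complex.Re (cdot (f 0) (cconj (f 0))).
  by rewrite -cnorm_sqr /= exprn_gt0 ?cnorm_gt0.
by eexists; exact: (is_derive1_comp (is_derive1_sqrt P0) dP).
Qed.

Lemma derivable_along (g : R -> R) (K : R) :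
  (forall x : R, 0 <= x <= 1 -> `|g x - g 0| <= K * x ^+ 2) ->
  (forall x : R, 0 < x -> exists dg, is_derive x (1 : R) g dg) ->
  exists r, is_derive (0 : R) (1 : R) (fun t => g (cnorm (xt t) / cnorm (zt t))) r.
Proof.
move=> g0 gpos.
have [x0|x0] := eqVneq (xt 0) 0; last first.
  have [p dp] := is_derive_cnorm dxt x0; have [q dq] := is_derive_cnorm dzt zt0.
  have [r dr] := is_deriveV_ex dq (lt0r_neq0 (cnorm_gt0 zt0)).
  have [|dg dgP] := gpos (cnorm (xt 0) / cnorm (zt 0)).
    by rewrite divr_gt0 ?cnorm_gt0.
  have dm := is_deriveM dp dr.
  by eexists; exact: (@is_derive1_comp _ g (fun t => cnorm (xt t) / cnorm (zt t)) _ _ _ dgP dm).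
pose P t := complex.Re (cdot (xt t) (cconj (xt t))).
pose Q t := complex.Re (cdot (zt t) (cconj (zt t))).
have dP := is_derive_cnorm_sqr dxt; have dQ := is_derive_cnorm_sqr dzt.
have P0 : P 0 = 0 by rewrite /P x0 cdot0l.
have Q0 : Q 0 != 0 by rewrite /Q -cnorm_sqr /= expf_neq0 // gt_eqF ?cnorm_gt0.
have [r dr] := is_deriveV_ex dQ Q0.
have mu_sqr t : (cnorm (xt t) / cnorm (zt t)) ^+ 2 = P t / Q t.
  by rewrite expr_div_n /P /Q -!cnorm_sqr.
have ds : is_derive (0 : R) (1 : R) (fun t => P t / Q t) 0.
  apply: is_derive_eq (is_deriveM dP dr) _.
  have -> : cdot dx (cconj (xt 0)) + cdot (xt 0) (cconj dx) = 0.
    by rewrite x0 cdot0l cdotC /cconj map_mx0 cdot0l addr0.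
  by rewrite [X in X *: r](P0) scale0r scaler0 addr0.
have s0 : P 0 / Q 0 = 0 by rewrite P0 mul0r.
exists 0; apply: (is_derive_quadratic (K := K) ds s0).
have cs : {for 0, continuous (fun t => P t / Q t)}.
  by apply: differentiable_continuous; apply/derivable1_diffP; have [] := ds.
have ns : \forall t \near (0 : R), `|P 0 / Q 0 - P t / Q t| < 1.
  exact: (cvgrPdist_lt _ _).1 cs _ ltr01.
apply: filterS ns => t; rewrite s0 sub0r normrN => ht.
have mu0 : cnorm (xt 0) / cnorm (zt 0) = 0.
  by apply/eqP; rewrite -sqrf_eq0 mu_sqr s0.
rewrite mu0 -mu_sqr; apply: g0; apply/andP; split.
  by rewrite divr_ge0 // sqrtr_ge0.
rewrite -(expr_le1 (n := 2)) //; last by rewrite divr_ge0 // sqrtr_ge0.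
by rewrite mu_sqr (le_trans (ler_norm _)) // ltW.
Qed.

End Velocity.

Section PhiVelocity.
Variables (R : realType) (n : nat).
Local Notation C := R[i].

Lemma is_cvderive_lincomb (A B : R -> 'rV[C]_n) dA dB (f g : R -> R) r s :
  is_cvderive 0 (1 : R) A dA -> is_cvderive 0 (1 : R) B dB ->
  is_derive (0 : R) (1 : R) f r -> is_derive (0 : R) (1 : R) g s ->
  is_cvderive 0 (1 : R) (fun t => (f t)%:C *: A t + ('i * (g t)%:C) *: B t)
    (((f 0)%:C *: dA + r%:C *: A 0) + 'i *: ((g 0)%:C *: dB + s%:C *: B 0)).
Proof.
move=> hA hB hf hg j.
have h1 := is_cderiveM (is_cderive_real hf) (hA j).
have h2 := is_cderiveZ 'i%R (is_cderiveM (is_cderive_real hg) (hB j)).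
have h := is_cderiveD h1 h2.
apply: (is_cderive_eq (near_is_cderive _ h)).
  by near=> t; rewrite !mxE mulrA.
by rewrite !mxE; congr (_ + 'i * _); rewrite addrC.
Unshelve. all: by end_near. Qed.

End PhiVelocity.

(** r and s are the derivatives of cosh mu and of sinh mu / mu along the curve. *)
Lemma Phi_velocity (R : realType) n (zt xt : R -> 'rV[R[i]]_n.+1) dz dx :
  is_cvderive 0 (1 : R) zt dz -> is_cvderive 0 (1 : R) xt dx -> zt 0 != 0 ->
  let mu := cnorm (xt 0) / cnorm (zt 0) in
  exists r s : R,
    let al := (cosh mu)%:C *: dz + r%:C *: zt 0 in
    let be := (sinhc mu)%:C *: dx + s%:C *: xt 0 in
    cvderive (1 : R) (fun t => Phi (zt t) (xt t)) 0 =
    row_mx (al + 'i *: be) (cconj al + 'i *: cconj be).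
Proof.
move=> hz hx z0 mu.
have [r hr] : exists r, is_derive (0 : R) (1 : R)
    (fun t => cosh (cnorm (xt t) / cnorm (zt t))) r.
  apply: (derivable_along z0 hz hx (K := expR 1)) => x.
    by rewrite cosh0; exact: cosh_quadratic.
  by move=> _; exists (sinh x); exact: is_derive_cosh.
have [s hs] : exists s, is_derive (0 : R) (1 : R)
    (fun t => sinhc (cnorm (xt t) / cnorm (zt t))) s.
  apply: (derivable_along z0 hz hx (K := expR 1)) => x.
    by rewrite {2}/sinhc eqxx; exact: sinhc_quadratic.
  exact: is_derive_sinhc.
exists r, s => al be; apply: cvderiveP.
have h1 := is_cvderive_lincomb hz hx hr hs.
have h2 := is_cvderive_lincomb (is_cvderive_conj hz) (is_cvderive_conj hx) hr hs.
have := is_cvderive_row_mx h1 h2.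
by rewrite /al /be !cconjD !cconjZ !conjc_real.
Qed.

(** * The Kaehler form in homogeneous coordinates *)
Section Lines.
Variables (R : realType) (V : normedModType R).
Local Notation C := R[i].

(** A directional derivative only sees the line through x.  This reduces the
    composition with a function of one variable, and the replacement of a function
    by one that agrees with it near x, to functions on the line. *)
Lemma is_derive_lineP (f : V -> R) x v l :
  is_derive x v f l <-> is_derive (0 : R) (1 : R) (fun t : R => f (t *: v + x)) l.
Proof.
have E : (fun h : R => h^-1 *: ((f \o shift x) (h *: v) - f x)) =
  (fun h : R => h^-1 *: (((fun t : R => f (t *: v + x)) \o shift (0 : R)) (h *: (1 : R))
     - f ((0 : R) *: v + x))).
  by apply/funext => h; rewrite /= scale0r add0r addr0 /GRing.scale /= mulr1.
split=> -[h1 h2]; apply: DeriveDef.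
- by move: h1; rewrite /derivable E.
- by move: h2; rewrite /derive E.
- by move: h1; rewrite /derivable E.
- by move: h2; rewrite /derive E.
Qed.

Lemma is_cderive_lineP (f : V -> C) x v l :
  is_cderive x v f l <-> is_cderive (0 : R) (1 : R) (fun t : R => f (t *: v + x)) l.
Proof.
by split=> -[h1 h2]; split; (exact/(is_derive_lineP (fun y => complex.Re (f y))) ||
  exact/(is_derive_lineP (fun y => complex.Im (f y)))).
Qed.

Lemma is_deriveV (f : V -> R) x v df : is_derive x v f df -> f x != 0 ->
  is_derive x v (fun y => (f y)^-1) (- (f x) ^- 2 * df).
Proof.
move=> [h <-] f0; apply: DeriveDef; first exact: derivableV f0 h.
exact: deriveV f0 h.
Qed.

Lemma is_derive_sqrt (f : V -> R) x v df : is_derive x v f df -> 0 < f x ->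
  is_derive x v (fun y => Num.sqrt (f y)) ((2 * Num.sqrt (f x))^-1 * df).
Proof.
move=> /is_derive_lineP h f0; apply/is_derive_lineP.
have e : f ((0 : R) *: v + x) = f x by rewrite scale0r add0r.
have f0' : 0 < f ((0 : R) *: v + x) by rewrite e.
have := @is_derive1_comp _ Num.sqrt (fun t : R => f (t *: v + x)) _ _ _
  (is_derive1_sqrt f0') h.
by rewrite e.
Qed.

Lemma invc_sqr (a b c d : R) : a * a + b * b != 0 ->
  - (c +i* d) / (a +i* b) ^+ 2 =
  (((b * b - a * a) * c - 2 * a * b * d) / (a * a + b * b) ^+ 2) +i*
  (((b * b - a * a) * d + 2 * a * b * c) / (a * a + b * b) ^+ 2) :> C.
Proof.
move=> nz; have ab0 : a +i* b != 0 :> C.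
  apply: contra nz; rewrite eq_complex /= => /andP[/eqP -> /eqP ->].
  by rewrite !mulr0 addr0.
apply: (mulIf (expf_neq0 2 ab0)); rewrite mulfVK ?expf_neq0 //.
by apply/eqP; rewrite eq_complex /=; apply/andP; split; apply/eqP; field; exact: nz.
Qed.

Lemma is_cderiveV (g : V -> C) x v l : is_cderive x v g l -> g x != 0 ->
  is_cderive x v (fun y => (g y)^-1) (- l / g x ^+ 2).
Proof.
move=> [h1 h2] g0.
pose nn y := complex.Re (g y) * complex.Re (g y) + complex.Im (g y) * complex.Im (g y).
have n0 : nn x != 0.
  apply: contra g0; rewrite /nn -!expr2 paddr_eq0 ?sqr_ge0 // !sqrf_eq0 eq_complex.
  by [].
set a := complex.Re (g x) in h1 h2 n0 *; set b := complex.Im (g x) in h1 h2 n0 *.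
set c := complex.Re l in h1; set d := complex.Im l in h2.
have dnn : is_derive x v nn (2 * (a * c + b * d)).
  apply: is_derive_eq (is_deriveD (is_deriveM h1 h1) (is_deriveM h2 h2)) _.
  by rewrite /GRing.scale /= -/a -/b; ring.
have dn := is_deriveV dnn n0.
have hr : is_derive x v (fun y => complex.Re (g y) * (nn y)^-1)
    (a * (- (nn x) ^- 2 * (2 * (a * c + b * d))) + (nn x)^-1 * c).
  exact: is_deriveM h1 dn.
have hi : is_derive x v (fun y => - (complex.Im (g y) * (nn y)^-1))
    (- (b * (- (nn x) ^- 2 * (2 * (a * c + b * d))) + (nn x)^-1 * d)).
  exact: is_deriveN (is_deriveM h2 dn).
have eR y : complex.Re (g y)^-1 = complex.Re (g y) * (nn y)^-1.
  by rewrite /nn -!expr2; case: (g y).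
have eI y : complex.Im (g y)^-1 = - (complex.Im (g y) * (nn y)^-1).
  by rewrite /nn -!expr2; case: (g y).
have nx : nn x = a * a + b * b by [].
have key : - l / g x ^+ 2 =
  (((b * b - a * a) * c - 2 * a * b * d) / (a * a + b * b) ^+ 2) +i*
  (((b * b - a * a) * d + 2 * a * b * c) / (a * a + b * b) ^+ 2).
  have eg : g x = a +i* b by rewrite /a /b; case: (g x).
  have el : l = c +i* d by rewrite /c /d; case: (l).
  rewrite {1}el eg; apply: invc_sqr; by rewrite -nx.
rewrite key; rewrite nx in n0 hr hi; split.
  apply: (near_eq_is_derive (f := fun y => complex.Re (g y) * (nn y)^-1)).
    by near=> y; rewrite eR.
  by apply: is_derive_eq hr _ => /=; field.
apply: (near_eq_is_derive (f := fun y => - (complex.Im (g y) * (nn y)^-1))).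
  by near=> y; rewrite eI.
by apply: is_derive_eq hi _ => /=; field.
Unshelve. all: by end_near. Qed.

End Lines.

Section Potential.
Variables (R : realType) (n : nat).
Local Notation C := R[i].
Local Notation N := n.+1.
Implicit Types (q X Y : 'rV[C]_(N + N)) (x v : 'rV[R]_((N + N) + (N + N))).

Definition zsqr q : C := cdot (lsubmx q) (cconj (lsubmx q)).
Definition wsqr q : C := cdot (rsubmx q) (cconj (rsubmx q)).
Definition pairing q : C := cdot (lsubmx q) (rsubmx q).
Definition potential q : R := 2 * Num.sqrt (calN q).

(** The components are the derivatives with respect to conj z_j and conj w_j of
    log |z|^2 + log |w|^2 - log |z . w|^2, which is twice the logarithm of the
    potential up to a constant. *)
Definition dlog q : 'rV[C]_(N + N) :=
  row_mx ((zsqr q)^-1 *: lsubmx q - (conjc (pairing q))^-1 *: cconj (rsubmx q))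
         ((wsqr q)^-1 *: rsubmx q - (conjc (pairing q))^-1 *: cconj (lsubmx q)).

Lemma Re_mul_conjc (a : C) : complex.Re (a * conjc a) = complex.Re `|a| ^+ 2.
Proof.
by case: a => a b; rewrite normc_def /= sqr_sqrtr ?addr_ge0 ?sqr_ge0 //; ring.
Qed.

Lemma Re_sqr_mul (a b : C) : complex.Re `|a * b| ^+ 2 =
  complex.Re `|a| ^+ 2 * complex.Re `|b| ^+ 2.
Proof. by rewrite -!Re_mul_conjc; case: a b => a b [c d] /=; ring. Qed.

Lemma Re_sum I (s : seq I) (f : I -> C) :
  complex.Re (\sum_(j <- s) f j) = \sum_(j <- s) complex.Re (f j).
Proof. by elim/big_rec2: _ => // j a b _ <-; rewrite ReD. Qed.

Lemma calNE q : calN q = complex.Re (zsqr q) * complex.Re (wsqr q) /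
  complex.Re (pairing q * conjc (pairing q)).
Proof.
rewrite /calN /= Re_mul_conjc; congr (_ / _).
rewrite /zsqr /wsqr /cdot !Re_sum mulr_suml; apply: eq_bigr => j _.
rewrite mulr_sumr; apply: eq_bigr => k _.
by rewrite !mxE Re_sqr_mul -!Re_mul_conjc.
Qed.

Lemma is_derive_coord m (x v : 'rV[R]_m) j :
  is_derive x v (fun y : 'rV[R]_m => y 0 j) (v 0 j).
Proof.
have di : differentiable (fun z : 'rV[R]_m => z) x by exact: ex_diff.
apply: DeriveDef; first exact/diff_derivable/differentiable_coord.
by rewrite -(derive_rV v j di) derive_id.
Qed.

Lemma is_cvderive_toC m (x v : 'rV[R]_(m + m)) : is_cvderive x v (@toC R m) (toC v).
Proof.
move=> j; rewrite mxE; split=> /=.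
  apply: near_eq_is_derive (is_derive_coord x v (lshift m j)).
  by near=> y; rewrite mxE.
apply: near_eq_is_derive (is_derive_coord x v (rshift m j)).
by near=> y; rewrite mxE.
Unshelve. all: by end_near. Qed.

Lemma is_cvderive_z x v : is_cvderive x v (fun y => lsubmx (toC y)) (lsubmx (toC v)).
Proof.
move=> j; have := is_cvderive_toC x v (lshift N j); rewrite [(lsubmx _) 0 j]mxE.
by apply: near_is_cderive; near=> y; rewrite [RHS]mxE.
Unshelve. all: by end_near. Qed.

Lemma is_cvderive_w x v : is_cvderive x v (fun y => rsubmx (toC y)) (rsubmx (toC v)).
Proof.
move=> j; have := is_cvderive_toC x v (rshift N j); rewrite [(rsubmx _) 0 j]mxE.
by apply: near_is_cderive; near=> y; rewrite [RHS]mxE.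
Unshelve. all: by end_near. Qed.

Definition dzsqr q X : C :=
  cdot (lsubmx X) (cconj (lsubmx q)) + cdot (lsubmx q) (cconj (lsubmx X)).
Definition dwsqr q X : C :=
  cdot (rsubmx X) (cconj (rsubmx q)) + cdot (rsubmx q) (cconj (rsubmx X)).
Definition dpairing q X : C :=
  cdot (lsubmx X) (rsubmx q) + cdot (lsubmx q) (rsubmx X).

Lemma is_cderive_zsqr x v :
  is_cderive x v (fun y => zsqr (toC y)) (dzsqr (toC x) (toC v)).
Proof. exact: is_cderive_cdot (is_cvderive_z x v) (is_cvderive_z x v). Qed.

Lemma is_cderive_wsqr x v :
  is_cderive x v (fun y => wsqr (toC y)) (dwsqr (toC x) (toC v)).
Proof. exact: is_cderive_cdot (is_cvderive_w x v) (is_cvderive_w x v). Qed.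

Lemma is_cderive_pairing x v :
  is_cderive x v (fun y => pairing (toC y)) (dpairing (toC x) (toC v)).
Proof.
have := is_cderive_cdot (is_cvderive_z x v) (is_cvderive_conj (is_cvderive_w x v)).
rewrite !cconjK; apply: near_is_cderive.
by near=> y; rewrite cconjK.
Unshelve. all: by end_near. Qed.

Lemma zsqr_gt0 q : pairing q != 0 -> exists2 r : R, zsqr q = r%:C & 0 < r.
Proof.
move=> p0; have [r e r0] := cdot_self (lsubmx q); exists r => //.
rewrite lt_neqAle r0 andbT eq_sym; apply: contra p0 => /eqP r00.
by rewrite /pairing (cdot_self_eq0 (u := lsubmx q)) ?cdot0l // e r00.
Qed.

Lemma wsqr_gt0 q : pairing q != 0 -> exists2 r : R, wsqr q = r%:C & 0 < r.
Proof.
move=> p0; have [r e r0] := cdot_self (rsubmx q); exists r => //.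
rewrite lt_neqAle r0 andbT eq_sym; apply: contra p0 => /eqP r00.
by rewrite /pairing cdotC (cdot_self_eq0 (u := rsubmx q)) ?cdot0l // e r00.
Qed.

Lemma conjc_zsqr q : conjc (zsqr q) = zsqr q.
Proof. by rewrite /zsqr conjc_cdot cconjK cdotC. Qed.

Lemma conjc_wsqr q : conjc (wsqr q) = wsqr q.
Proof. by rewrite /wsqr conjc_cdot cconjK cdotC. Qed.

Lemma dzsqrE q X : dzsqr q X = cdot (lsubmx X) (cconj (lsubmx q)) +
  conjc (cdot (lsubmx X) (cconj (lsubmx q))).
Proof. by rewrite conjc_cdot cconjK (cdotC (cconj _)). Qed.

Lemma dwsqrE q X : dwsqr q X = cdot (rsubmx X) (cconj (rsubmx q)) +
  conjc (cdot (rsubmx X) (cconj (rsubmx q))).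
Proof. by rewrite conjc_cdot cconjK (cdotC (cconj _)). Qed.

Lemma cdot_row_mx m p (a c : 'rV[C]_m) (b d : 'rV[C]_p) :
  cdot (row_mx a b) (row_mx c d) = cdot a c + cdot b d.
Proof. by rewrite !cdotE tr_row_mx mul_row_col mxE. Qed.

Lemma cdotBr m (u a b : 'rV[C]_m) : cdot u (a - b) = cdot u a - cdot u b.
Proof. by rewrite cdotDr -scaleN1r cdotZr mulN1r. Qed.

Lemma cdot_dlog q X : cdot X (cconj (dlog q)) =
  (zsqr q)^-1 * cdot (lsubmx X) (cconj (lsubmx q)) +
  (wsqr q)^-1 * cdot (rsubmx X) (cconj (rsubmx q)) -
  (pairing q)^-1 * dpairing q X.
Proof.
have e (a b : C) (u v : 'rV[C]_N) :
    cconj (a *: u - b *: cconj v) = conjc a *: cconj u - conjc b *: v.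
  by rewrite cconjB !cconjZ cconjK.
have c (a b : C) (t u v : 'rV[C]_N) :
    cdot t (a *: u - b *: v) = a * cdot t u - b * cdot t v.
  by rewrite cdotBr !cdotZr.
have H (a b p : C) (x y z w : 'rV[C]_N) :
    cdot (row_mx x y) (row_mx (cconj (a *: z - p *: cconj w))
                              (cconj (b *: w - p *: cconj z))) =
    conjc a * cdot x (cconj z) + conjc b * cdot y (cconj w) -
    conjc p * (cdot x w + cdot z y).
  by rewrite cdot_row_mx !e !c (cdotC z); ring.
rewrite -{1}[X]hsubmxK [cconj _]map_row_mx [LHS]H.
by rewrite !fmorphV /= conjc_zsqr conjc_wsqr conjcK.
Qed.

Lemma Re_real_mul (r : R) (a : C) : complex.Re (r%:C * a) = r * complex.Re a.
Proof. by case: a => a b /=; rewrite mul0r subr0. Qed.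

Lemma Re_inv_mul (p a : C) : complex.Re (p^-1 * a) =
  complex.Re (a * conjc p) / complex.Re (p * conjc p).
Proof.
case: p a => c d [a b] /=.
have -> : c * c - d * - d = c ^+ 2 + d ^+ 2 by ring.
by move: (c ^+ 2 + d ^+ 2) => m; ring.
Qed.

Lemma is_derive_potential x v : pairing (toC x) != 0 ->
  is_derive x v (fun y => potential (toC y))
    (potential (toC x) * complex.Re (cdot (toC v) (cconj (dlog (toC x))))).
Proof.
move=> p0; have [r er r0] := zsqr_gt0 p0; have [s es s0] := wsqr_gt0 p0.
have [hz _] := is_cderive_zsqr x v; have [hw _] := is_cderive_wsqr x v.
have hp := is_cderive_pairing x v.
have [hb _] := is_cderiveM hp (is_cderive_conj hp).
set q := toC x in p0 er es hz hw hb *; set X := toC v in hz hw hb *.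
pose b := complex.Re (pairing q * conjc (pairing q)).
have b0 : 0 < b.
  rewrite /b Re_mul_conjc exprn_gt0 //; move: p0; case: (pairing q) => c d.
  rewrite normc_def /= sqrtr_gt0 eq_complex /= negb_and => cd.
  rewrite lt_neqAle addr_ge0 ?sqr_ge0 // andbT eq_sym paddr_eq0 ?sqr_ge0 //.
  by rewrite !sqrf_eq0 negb_and.
have rs0 : 0 < r * s / b by rewrite divr_gt0 ?mulr_gt0.
have eN : calN q = r * s / b by rewrite calNE er es.
have hbi := is_deriveV hb (lt0r_neq0 b0).
have hN := is_deriveM (is_deriveM hz hw) hbi.
have hS : is_derive x v (fun y => calN (toC y))
    (calN q * (2 * complex.Re (cdot X (cconj (dlog q))))).
  apply: (near_eq_is_derive (f := fun y => complex.Re (zsqr (toC y)) *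
    complex.Re (wsqr (toC y)) * (complex.Re (pairing (toC y) * conjc (pairing (toC y))))^-1)).
    by near=> y; rewrite calNE.
  apply: is_derive_eq hN _; rewrite eN cdot_dlog er es dzsqrE dwsqrE.
  rewrite -!fmorphV ReB !ReD !Re_conjc !Re_real_mul Re_inv_mul // -/b.
  rewrite /GRing.scale /=.
  have e1 : ((fun y => complex.Re (zsqr (toC y))) *
             (fun y => complex.Re (wsqr (toC y)))) x = r * s.
    by rewrite -[LHS]/(complex.Re (zsqr q) * complex.Re (wsqr q)) er es.
  have e2 : complex.Re (pairing q * conjc (dpairing q X)) =
            complex.Re (dpairing q X * conjc (pairing q)).
    by rewrite -[RHS]Re_conjc conjcM conjcK mulrC.
  rewrite e1 e2; move: (complex.Re (cdot _ _)) (complex.Re (cdot _ _)) (complex.Re _).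
  by move=> A D E; field; rewrite !gt_eqF.
have hF := is_derive_sqrt hS _; rewrite -/q eN in hF.
apply: is_derive_eq (is_deriveZ 2 (hF rs0)) _.
rewrite /GRing.scale /= /potential eN; set S := Num.sqrt _.
have S0 : S != 0 by rewrite gt_eqF // sqrtr_gt0.
have -> : r * s / b = S ^+ 2 by rewrite sqr_sqrtr // ltW.
by field.
Unshelve. all: by end_near. Qed.

End Potential.

Section Hessian.
Variables (R : realType) (n : nat).
Local Notation C := R[i].
Local Notation N := n.+1.
Implicit Types (q X Y : 'rV[C]_(N + N)) (x v : 'rV[R]_((N + N) + (N + N))).

(** The matrix of second derivatives, with respect to z_i and conj z_j, of
    log |z|^2. *)
Definition proj_hessian (z : 'rV[C]_N) : 'M[C]_N :=
  let r := cdot z (cconj z) in r^-1%:M - r ^- 2 *: ((cconj z)^T *m z).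

(** The complex linear and the antilinear part in X of the derivative of
    [dlog] in the direction X. *)
Definition dlog_lin q X : 'rV[C]_(N + N) :=
  X *m block_mx (proj_hessian (lsubmx q)) 0 0 (proj_hessian (rsubmx q)).

Definition dlog_anti q X : 'rV[C]_(N + N) :=
  row_mx
   (conjc (dpairing q X) / conjc (pairing q) ^+ 2 *: cconj (rsubmx q)
    - (cdot (lsubmx q) (cconj (lsubmx X)) / zsqr q ^+ 2 *: lsubmx q
       + (conjc (pairing q))^-1 *: cconj (rsubmx X)))
   (conjc (dpairing q X) / conjc (pairing q) ^+ 2 *: cconj (lsubmx q)
    - (cdot (rsubmx q) (cconj (rsubmx X)) / wsqr q ^+ 2 *: rsubmx q
       + (conjc (pairing q))^-1 *: cconj (lsubmx X))).

Lemma mul_proj_hessian (z u : 'rV[C]_N) : u *m proj_hessian z =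
  (cdot z (cconj z))^-1 *: u -
  (cdot u (cconj z) / cdot z (cconj z) ^+ 2) *: z.
Proof.
rewrite /proj_hessian mulmxBr mul_mx_scalar -scalemxAr mulmxA; congr (_ - _).
have -> : u *m (cconj z)^T = (cdot u (cconj z))%:M by rewrite [LHS]mx11_scalar cdotE.
by rewrite mul_scalar_mx scalerA mulrC.
Qed.

Lemma dlog_linE q X : dlog_lin q X = row_mx
  ((zsqr q)^-1 *: lsubmx X - (cdot (lsubmx X) (cconj (lsubmx q)) / zsqr q ^+ 2) *: lsubmx q)
  ((wsqr q)^-1 *: rsubmx X - (cdot (rsubmx X) (cconj (rsubmx q)) / wsqr q ^+ 2) *: rsubmx q).
Proof.
rewrite /dlog_lin -{1}[X]hsubmxK mul_row_block !mulmx0 addr0 add0r.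
by rewrite !mul_proj_hessian.
Qed.

Lemma is_cvderive_dlog x v : pairing (toC x) != 0 ->
  is_cvderive x v (fun y => dlog (toC y))
    (dlog_lin (toC x) (toC v) + dlog_anti (toC x) (toC v)).
Proof.
move=> p0; have [r er r0] := zsqr_gt0 p0; have [s es s0] := wsqr_gt0 p0.
have z0 : zsqr (toC x) != 0 by rewrite er fmorph_eq0 gt_eqF.
have w0 : wsqr (toC x) != 0 by rewrite es fmorph_eq0 gt_eqF.
have cp0 : conjc (pairing (toC x)) != 0 by rewrite conjc_eq0.
have hz := is_cvderive_z x v; have hw := is_cvderive_w x v.
have hp := is_cderiveV (is_cderive_conj (is_cderive_pairing x v)) cp0.
have h1 := is_cvderiveB (is_cvderiveZ (is_cderiveV (is_cderive_zsqr x v) z0) hz)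
                        (is_cvderiveZ hp (is_cvderive_conj hw)).
have h2 := is_cvderiveB (is_cvderiveZ (is_cderiveV (is_cderive_wsqr x v) w0) hw)
                        (is_cvderiveZ hp (is_cvderive_conj hz)).
have := is_cvderive_row_mx h1 h2; rewrite -/(dlog _).
rewrite dlog_linE /dlog_anti add_row_mx.
set L := row_mx _ _; set L' := row_mx _ _ => H.
suff <- : L = L' by [].
rewrite /L /L' /dzsqr /dwsqr.
have E (c d e f g : C) (a b z w : 'rV[C]_N) :
  - (d + e) * f *: z + c *: a - (- g *: w + b) =
  c *: a - (d * f) *: z + (g *: w - (e * f *: z + b)).
  by apply/rowP => j; rewrite !mxE; ring.
by congr row_mx; rewrite -E !mulNr.
Qed.

Lemma toC_deltal m (a : 'I_m) : @toC R m (delta_mx 0 (lshift m a)) = delta_mx 0 a.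
Proof.
by apply/rowP => j; rewrite !mxE eq_lshift eq_rlshift /=; case: (j == a).
Qed.

Lemma toC_deltar m (a : 'I_m) : @toC R m (delta_mx 0 (rshift m a)) = 'i *: delta_mx 0 a.
Proof.
apply/rowP => j; rewrite !mxE eq_rshift eq_lrshift /=.
by case: (j == a); rewrite ?mulr1 ?mulr0.
Qed.

Lemma cdot_delta m (a : 'I_m) (u : 'rV[C]_m) : cdot (delta_mx 0 a) u = u 0 a.
Proof. by rewrite cdotE -rowE !mxE. Qed.

Lemma d_dzbar_potential x b : pairing (toC x) != 0 ->
  d_dzbar b (fun y => (potential (toC y))%:C) x =
  2^-1 * ((potential (toC x))%:C * dlog (toC x) 0 b).
Proof.
move=> p0; rewrite /d_dzbar.
have H v := cderiveP (is_cderive_real (is_derive_potential v p0)).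
rewrite !H toC_deltal toC_deltar cdotZl !cdot_delta mxE; congr (_ * _).
move: (potential _) (dlog _ 0 b) => f [c d].
by apply/eqP; rewrite eq_complex /=; apply/andP; split; apply/eqP; ring.
Qed.

Lemma near_line_pairing x v : pairing (toC x) != 0 ->
  \forall t \near (0 : R), pairing (toC (t *: v + x)) != 0.
Proof.
move=> p0; have /is_cderive_lineP[[h1 _] [h2 _]] := is_cderive_pairing x v.
have e : toC ((0 : R) *: v + x) = toC x by rewrite scale0r add0r.
have c1 := differentiable_continuous ((derivable1_diffP _ _).1 h1).
have c2 := differentiable_continuous ((derivable1_diffP _ _).1 h2).
move: p0; rewrite -{1}e eq_complex negb_and => /orP[] p0.
  have H : \forall t \near (0 : R), complex.Re (pairing (toC (t *: v + x))) != 0.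
    exact: cvgr_neq0 c1 p0.
  by apply: filterS H => t; apply: contra => /eqP ->.
have H : \forall t \near (0 : R), complex.Im (pairing (toC (t *: v + x))) != 0.
  exact: cvgr_neq0 c2 p0.
by apply: filterS H => t; apply: contra => /eqP ->.
Qed.

Lemma is_cderive_d_dzbar_potential x v b : pairing (toC x) != 0 ->
  is_cderive x v (d_dzbar b (fun y => (potential (toC y))%:C))
   (2^-1 * (potential (toC x))%:C *
     ((complex.Re (cdot (toC v) (cconj (dlog (toC x)))))%:C * dlog (toC x) 0 b +
      (dlog_lin (toC x) (toC v) 0 b + dlog_anti (toC x) (toC v) 0 b))).
Proof.
move=> p0; apply/is_cderive_lineP.
have h := is_cderiveZ 2^-1 (is_cderiveM (is_cderive_real (is_derive_potential v p0))
                            (is_cvderive_dlog v p0 b)).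
have /is_cderive_lineP h' := h.
apply: is_cderive_eq (near_is_cderive _ h') _.
  by apply: filterS (near_line_pairing v p0) => t pt; rewrite d_dzbar_potential.
rewrite rmorphM [(_ + _ : 'rV_(_)) 0 b]mxE.
by move: (dlog _ 0 b) (dlog_lin _ _ 0 b) (dlog_anti _ _ 0 b) => ? ? ?; ring.
Qed.

End Hessian.

Section OmegaFormula.
Variables (R : realType) (n : nat).
Local Notation C := R[i].
Local Notation N := n.+1.
Implicit Types (q X Y : 'rV[C]_(N + N)).

Lemma dlog_anti_i q X : dlog_anti q ('i *: X) = - 'i *: dlog_anti q X.
Proof.
have el : lsubmx ('i *: X) = 'i *: lsubmx X by exact: linearZ.
have er : rsubmx ('i *: X) = 'i *: rsubmx X by exact: linearZ.
have e1 : dpairing q ('i *: X) = 'i * dpairing q X.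
  by rewrite /dpairing el er cdotZl cdotZr mulrDr.
have e2 (u : 'rV[C]_N) : cconj ('i *: u) = - 'i *: cconj u.
  by rewrite cconjZ conjc_imag.
have E (c d e f p : C) (u v w : 'rV[C]_N) :
    - 'i * c * e *: u - (- 'i * d * f *: v + p *: (- 'i *: w)) =
    - 'i *: (c * e *: u - (d * f *: v + p *: w)).
  by apply/rowP => j; rewrite !mxE; ring.
rewrite /dlog_anti e1 conjcM conjc_imag el er !e2 !cdotZr.
by rewrite !E [RHS]scale_row_mx.
Qed.

(** The combination D_v - i D_(i v) keeps twice the complex linear part of a
    derivative and kills its antilinear part. *)
Lemma d_dz_d_dzbar_potential q a b : pairing q != 0 ->
  d_dz a (d_dzbar b (fun y => (potential (toC y))%:C)) (ofC q) =
  2^-1 * (potential q)%:C *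
  (2^-1 * conjc (dlog q 0 a) * dlog q 0 b + dlog_lin q (delta_mx 0 a) 0 b).
Proof.
move=> p0; have p0' : pairing (toC (ofC q)) != 0 by rewrite ofCK.
rewrite /d_dz !(cderiveP (is_cderive_d_dzbar_potential _ _ p0')) ofCK.
rewrite toC_deltal toC_deltar dlog_anti_i.
have -> : dlog_lin q ('i *: delta_mx 0 a) = 'i *: dlog_lin q (delta_mx 0 a).
  by rewrite /dlog_lin -scalemxAl.
have eZ (c : C) (u : 'rV[C]_(N + N)) : (c *: u) 0 b = c * u 0 b by rewrite mxE.
rewrite cdotZl cdot_delta [cconj _ 0 a]mxE !eZ.
move: (dlog q 0 b) (conjc (dlog q 0 a)) (dlog_lin _ _ 0 b) (dlog_anti _ _ 0 b).
move: (potential q) => f g t l m.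
have E : (complex.Re t)%:C * g + (l + m) -
   'i * ((complex.Re ('i * t))%:C * g + ('i * l + - 'i * m)) = t * g + 2 * l.
  case: t g l m => t1 t2 [g1 g2] [l1 l2] [m1 m2].
  by apply/eqP; rewrite eq_complex /=; apply/andP; split; apply/eqP; ring.
have h2 : 2^-1 * 2 = 1 :> C by rewrite mulVf // pnatr_eq0.
transitivity (2^-1 * (2^-1 * f%:C) * (t * g + 2 * l)); first by rewrite -E; ring.
transitivity (2^-1 * f%:C * (2^-1 * t * g + 2^-1 * 2 * l)); first by ring.
by rewrite h2 mul1r.
Qed.

(** With f the potential, f / 2 times this form is the complex Hessian of f.
    Indeed the latter is f times the sum of the complex Hessian of log f and of
    the product of its first derivatives, and [dlog] differentiates 2 log f. *)
Definition hess q X Y : C :=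
  2^-1 * (cdot X (cconj (dlog q)) * conjc (cdot Y (cconj (dlog q)))) +
  cdot (dlog_lin q X) (cconj Y).

Lemma sum_hess q X Y :
  \sum_a \sum_b (2^-1 * conjc (dlog q 0 a) * dlog q 0 b +
                 dlog_lin q (delta_mx 0 a) 0 b) * (X 0 a * conjc (Y 0 b)) =
  hess q X Y.
Proof.
under eq_bigr => a _ do under eq_bigr => b _ do rewrite mulrDl.
under eq_bigr => a _ do rewrite big_split.
rewrite big_split /= /hess; congr (_ + _).
  rewrite conjc_cdot cconjK /cdot mulr_suml mulr_sumr; apply: eq_bigr => a _.
  rewrite mulr_sumr mulr_sumr; apply: eq_bigr => b _; rewrite !mxE.
  by move: (dlog q 0 a) (dlog q 0 b) => g h; ring.
rewrite exchange_big /=; apply: eq_bigr => b _.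
rewrite [dlog_lin q X 0 b]mxE mulr_suml; apply: eq_bigr => a _.
by rewrite /dlog_lin -rowE !mxE mulrCA mulrA.
Qed.

Lemma OmegaE q X Y : pairing q != 0 ->
  Omega q X Y = 'i * (2^-1 * (potential q)%:C) * (hess q X Y - hess q Y X).
Proof.
move=> p0; rewrite /Omega /i_ddbar -[RHS]mulrA; congr (_ * _).
rewrite -!sum_hess -sumrB mulr_sumr; apply: eq_bigr => a _; rewrite -sumrB mulr_sumr.
apply: eq_bigr => b _; rewrite -mulrBr mulrA; congr (_ * _).
exact: d_dz_d_dzbar_potential.
Qed.

End OmegaFormula.

Section OmegaNormal.
Variables (R : realType) (n : nat).
Local Notation C := R[i].
Local Notation N := n.+1.
Implicit Types (u v s t al be z w x y : 'rV[C]_N).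

Lemma conjc_cdotr u v : conjc (cdot u (cconj v)) = cdot v (cconj u).
Proof. by rewrite conjc_cdot cconjK cdotC. Qed.

Lemma conjc_cdotl u v : conjc (cdot (cconj u) v) = cdot (cconj v) u.
Proof. by rewrite conjc_cdot cconjK cdotC. Qed.

Lemma cdot_dlog_row z w x y : cdot (row_mx x y) (cconj (dlog (row_mx z w))) =
  (cdot z (cconj z))^-1 * cdot x (cconj z) + (cdot w (cconj w))^-1 * cdot y (cconj w)
  - (cdot z w)^-1 * (cdot x w + cdot z y).
Proof. by rewrite cdot_dlog /zsqr /wsqr /pairing /dpairing !row_mxKl !row_mxKr. Qed.

Lemma cdot_dlog_lin_row z w x y x' y' :
  cdot (dlog_lin (row_mx z w) (row_mx x y)) (cconj (row_mx x' y')) =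
  (cdot z (cconj z))^-1 * cdot x (cconj x') -
    cdot x (cconj z) / cdot z (cconj z) ^+ 2 * cdot z (cconj x') +
  ((cdot w (cconj w))^-1 * cdot y (cconj y') -
    cdot y (cconj w) / cdot w (cconj w) ^+ 2 * cdot w (cconj y')).
Proof.
have E (c d : C) (u v t : 'rV[C]_N) :
    cdot (c *: u - d *: v) t = c * cdot u t - d * cdot v t.
  by rewrite (cdotC _ t) cdotBr !cdotZr !(cdotC t).
have -> : cconj (row_mx x' y') = row_mx (cconj x') (cconj y') by exact: map_row_mx.
by rewrite dlog_linE cdot_row_mx !E /zsqr /wsqr !row_mxKl !row_mxKr.
Qed.

(** For each of the two vectors, the products of its components with z and w are
    conjugate and its derivative of z . w is real; so the (1,0)-part of the
    differential of log f is real on it, for f the potential.  The last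
    condition makes the Fubini-Study terms symmetric. *)
Lemma Omega_row_eq0 z w x1 y1 x2 y2 (m1 m2 : C) :
  cdot z w != 0 -> conjc (cdot z w) = cdot z w ->
  cdot w (cconj w) = cdot z (cconj z) ->
  cdot x1 (cconj z) = m1 -> cdot y1 (cconj w) = conjc m1 ->
  cdot x2 (cconj z) = m2 -> cdot y2 (cconj w) = conjc m2 ->
  conjc (cdot x1 w + cdot z y1) = cdot x1 w + cdot z y1 ->
  conjc (cdot x2 w + cdot z y2) = cdot x2 w + cdot z y2 ->
  cdot x1 (cconj x2) + cdot y1 (cconj y2) = cdot x2 (cconj x1) + cdot y2 (cconj y1) ->
  Omega (row_mx z w) (row_mx x1 y1) (row_mx x2 y2) = 0.
Proof.
move=> p0 pc wz hx1 hy1 hx2 hy2 d1 d2 sym.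
rewrite OmegaE; last by rewrite /pairing row_mxKl row_mxKr.
have zx1 : cdot z (cconj x1) = conjc m1 by rewrite -hx1 conjc_cdotr.
have zx2 : cdot z (cconj x2) = conjc m2 by rewrite -hx2 conjc_cdotr.
have wy1 : cdot w (cconj y1) = m1 by rewrite -conjc_cdotr hy1 conjcK.
have wy2 : cdot w (cconj y2) = m2 by rewrite -conjc_cdotr hy2 conjcK.
have rc : conjc (cdot z (cconj z)) = cdot z (cconj z) by exact: conjc_cdotr.
rewrite /hess !cdot_dlog_row !cdot_dlog_lin_row wz hx1 hy1 hx2 hy2 zx1 zx2 wy1 wy2.
move: (cdot x1 w + _) (cdot x2 w + _) d1 d2 => e1 e2 d1 d2.
rewrite !conjcB !conjcD !conjcM !conjc_inv pc rc !conjcK d1 d2.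
move: (cdot z (cconj z)) (cdot z w) (conjc m1) (conjc m2) => r p c1 c2.
set A := cdot x1 (cconj x2) in sym *; set B := cdot y1 (cconj y2) in sym *.
set A' := cdot x2 (cconj x1) in sym *; set B' := cdot y2 (cconj y1) in sym *.
rewrite [X in _ * X](_ : _ = r^-1 * (A + B) - r^-1 * (A' + B')); last by ring.
by rewrite sym subrr mulr0.
Qed.

Lemma cdot_lincomb (c d e f : C) u v s t :
  cdot (c *: u + d *: v) (e *: s + f *: t) =
  c * e * cdot u s + c * f * cdot u t + d * e * cdot v s + d * f * cdot v t.
Proof. by rewrite cdotDl !cdotZl !cdotDr !cdotZr; ring. Qed.

Lemma cdot_addi (c e f : C) u v s t :
  cdot (u + c *: v) (e *: s + f *: t) =
  e * cdot u s + f * cdot u t + c * e * cdot v s + c * f * cdot v t.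
Proof. by rewrite -{1}[u]scale1r cdot_lincomb !mul1r. Qed.

Lemma cdot_addi2 (c f : C) u v s t :
  cdot (u + c *: v) (s + f *: t) =
  cdot u s + f * cdot u t + c * cdot v s + c * f * cdot v t.
Proof. by rewrite -{1}[s]scale1r cdot_addi mulr1 !mul1r. Qed.

Lemma cconj_lincomb (c d : R) u v :
  cconj (c%:C *: u + ('i * d%:C) *: v) = c%:C *: cconj u + (- 'i * d%:C) *: cconj v.
Proof. by rewrite cconjD !cconjZ conjcM !conjc_real conjc_imag. Qed.

Lemma cconj_addi u v : cconj (u + 'i *: v) = cconj u + (- 'i) *: cconj v.
Proof. by rewrite cconjD cconjZ conjc_imag. Qed.

Lemma imag_mul_imag : 'i * 'i = -1 :> C. Proof. by rewrite -expr2 sqrCi. Qed.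

Variables (a b : R) (zeta xi : 'rV[C]_N).
Hypothesis xz : cdot xi (cconj zeta) = 0.
Let z := a%:C *: zeta + ('i * b%:C) *: xi.
Let w := a%:C *: cconj zeta + ('i * b%:C) *: cconj xi.
Let cz : cconj z = a%:C *: cconj zeta + (- 'i * b%:C) *: cconj xi.
Proof. exact: cconj_lincomb. Qed.
Let cw : cconj w = a%:C *: zeta + (- 'i * b%:C) *: xi.
Proof. by rewrite [LHS]cconj_lincomb !cconjK. Qed.
Let zx : cdot zeta (cconj xi) = 0.
Proof. by rewrite -conjc_cdotr xz conjc0. Qed.

Lemma cdot_zw : cdot z w =
  a%:C * a%:C * cdot zeta (cconj zeta) - b%:C * b%:C * cdot xi (cconj xi).
Proof. by rewrite [LHS]cdot_lincomb xz zx; ring: imag_mul_imag. Qed.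

Lemma cdot_zz : cdot z (cconj z) =
  a%:C * a%:C * cdot zeta (cconj zeta) + b%:C * b%:C * cdot xi (cconj xi).
Proof. by rewrite cz [LHS]cdot_lincomb xz zx; ring: imag_mul_imag. Qed.

Lemma cdot_ww : cdot w (cconj w) =
  a%:C * a%:C * cdot zeta (cconj zeta) + b%:C * b%:C * cdot xi (cconj xi).
Proof.
rewrite cw [LHS]cdot_lincomb !(cdotC (cconj _)) xz zx; ring: imag_mul_imag.
Qed.

Definition moment al be : C :=
  a%:C * cdot al (cconj zeta) + b%:C * cdot be (cconj xi).

Section Tangent.
Variables (al be : 'rV[C]_N).
Hypotheses (ax : cdot al (cconj xi) = 0) (bz : cdot be (cconj zeta) = 0).
Let x := al + 'i *: be.
Let y := cconj al + 'i *: cconj be.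
Let ax' : cdot (cconj al) xi = 0.
Proof. by rewrite -[LHS]conjcK conjc_cdotl cdotC ax conjc0. Qed.
Let bz' : cdot (cconj be) zeta = 0.
Proof. by rewrite -[LHS]conjcK conjc_cdotl cdotC bz conjc0. Qed.

Lemma cdot_x_cconj_z : cdot x (cconj z) = moment al be.
Proof. by rewrite cz [LHS]cdot_addi ax bz /moment; ring: imag_mul_imag. Qed.

Lemma cdot_y_cconj_w : cdot y (cconj w) = conjc (moment al be).
Proof.
rewrite cw [LHS]cdot_addi ax' bz' /moment conjcD !conjcM !conjc_real !conjc_cdotr.
rewrite !(cdotC (cconj _)); ring: imag_mul_imag.
Qed.

Lemma conjc_dpairing_xy : conjc (cdot x w + cdot z y) = cdot x w + cdot z y.
Proof.
have -> : cdot x w + cdot z y =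
    (a%:C * cdot al (cconj zeta) - b%:C * cdot be (cconj xi)) +
    (a%:C * cdot zeta (cconj al) - b%:C * cdot xi (cconj be)).
  rewrite (cdotC z) [cdot x w]cdot_addi [cdot y z]cdot_addi ax bz ax' bz'.
  rewrite !(cdotC (cconj _)); ring: imag_mul_imag.
rewrite conjcD !conjcB !conjcM !conjc_real !conjc_cdotr; ring.
Qed.

End Tangent.

(** The real part of the last hypothesis is the vanishing of the canonical
    symplectic form on two tangent vectors of the conormal bundle. *)
Lemma Omega_normal al1 be1 al2 be2 : cdot z w != 0 ->
  cdot al1 (cconj xi) = 0 -> cdot be1 (cconj zeta) = 0 ->
  cdot al2 (cconj xi) = 0 -> cdot be2 (cconj zeta) = 0 ->
  cdot be1 (cconj al2) = cdot be2 (cconj al1) ->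
  Omega (row_mx z w) (row_mx (al1 + 'i *: be1) (cconj al1 + 'i *: cconj be1))
                     (row_mx (al2 + 'i *: be2) (cconj al2 + 'i *: cconj be2)) = 0.
Proof.
move=> p0 ax1 bz1 ax2 bz2 sym.
apply: (Omega_row_eq0 p0 _ _ (cdot_x_cconj_z ax1 bz1) (cdot_y_cconj_w ax1 bz1)
  (cdot_x_cconj_z ax2 bz2) (cdot_y_cconj_w ax2 bz2)
  (conjc_dpairing_xy ax1 bz1) (conjc_dpairing_xy ax2 bz2)).
- by rewrite cdot_zw conjcB !conjcM !conjc_real !conjc_cdotr.
- by rewrite cdot_ww cdot_zz.
have sym' : cdot al1 (cconj be2) = cdot al2 (cconj be1).
  by rewrite -conjc_cdotr -sym conjc_cdotr.
rewrite !cconj_addi !cconjK !cdot_addi2 !(cdotC (cconj _)).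
by rewrite sym sym'; ring: imag_mul_imag.
Qed.

End OmegaNormal.

(** * Determinants with a constant phase *)
Section PhaseAlgebra.
Variables (K : fieldType) (conj : {rmorphism K -> K}).
Hypothesis conjK : involutive conj.
Local Notation cj := (map_mx conj).

Lemma map_mxK m n : involutive (fun A : 'M[K]_(m, n) => cj A).
Proof. by move=> A; apply/matrixP => i j; rewrite !mxE conjK. Qed.

(** With [map_mx conj] this is the real structure (x, y) |-> (conj y, conj x),
    whose fixed vectors are the pairs (u, conj u). *)
Definition swap_mx N : 'M[K]_(N + N) := block_mx 0 1%:M 1%:M 0.

Lemma mul_swap_mx N m (x y : 'M[K]_(m, N)) :
  row_mx x y *m swap_mx N = row_mx y x.
Proof. by rewrite mul_row_block !mulmx0 !mulmx1 addr0 add0r. Qed.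

Lemma swap_block_swap N (A B D E : 'M[K]_N) :
  swap_mx N *m block_mx A B D E *m swap_mx N = block_mx E D B A.
Proof.
by rewrite /swap_mx !mulmx_block !(mul0mx, mulmx0, mul1mx, mulmx1, addr0, add0r).
Qed.

Lemma diag_block_diag N (A B D E L M : 'M[K]_N) :
  block_mx 1%:M 0 0 (- 1%:M) *m block_mx A B D E *m block_mx L 0 0 (- M) =
  block_mx (A *m L) (- (B *m M)) (- (D *m L)) (E *m M).
Proof.
rewrite !mulmx_block !(mul0mx, mulmx0, mul1mx, mulmx1, addr0, add0r).
by rewrite !mulNmx !mulmxN !mul1mx opprK.
Qed.

Lemma det_swap_mx_sqr N : \det (swap_mx N) ^+ 2 = 1.
Proof.
rewrite expr2 -det_mulmx /swap_mx mulmx_block !mulmx0 !mul0mx !mulmx1.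
by rewrite !addr0 !add0r -scalar_mx_block det1.
Qed.

Lemma det_involution_conj N (E : 'M[K]_N) :
  E *m E = 1%:M -> \det E * conj (\det E) = 1.
Proof.
move=> /(congr1 determinant); rewrite det_mulmx det1 -expr2 => /eqP.
by rewrite sqrf_eq1 => /orP[] /eqP ->; rewrite ?rmorphN rmorph1 ?mulrNN mulr1.
Qed.

Variables (i a b : K).
Hypotheses (conji : conj i = - i) (conja : conj a = a) (conjb : conj b = b).

(** Acts on row vectors (x, y), which form the complexification of the real space
    of the pairs (u, conj u).  If A : u |-> conj u *m S vanishes on the kernel of
    the projection P, this matrix is a - i b A on the complexified image of P and
    i on the complexified kernel. *)
Definition graph_mx N (P S : 'M[K]_N) : 'M[K]_(N + N) :=
  block_mx (a *: P + i *: (1%:M - P)) (- (i * b) *: cj S)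
           (- (i * b) *: S) (a *: cj P + i *: (1%:M - cj P)).

(** Conjugation turns i into - i.  The same effect is obtained with E, the
    reflection that is 1 on the image of P and - 1 on its kernel, and with the
    change of sign of y, since S exchanges x and y.  The sign changes contribute
    (-1)^N twice and det E contributes |det E|^2 = 1. *)
Lemma det_graph_mx_conj N (P S : 'M[K]_N) :
  P *m P = P -> S *m P = S -> conj (\det (graph_mx P S)) = \det (graph_mx P S).
Proof.
move=> PP SP.
have [E defE] : exists E, E = P *+ 2 - 1%:M by exists (P *+ 2 - 1%:M).
have EE : E *m E = 1%:M.
  rewrite defE mulmxBl !mulmxBr mul1mx !mulmx1 mulr2n !(mulmxDl, mulmxDr) PP.
  by apply/matrixP => k l; rewrite !mxE; ring.
have PE : P *m E = P by rewrite defE mulmxBr mulr2n mulmxDr PP mulmx1 addrK.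
have cPE : cj P *m cj E = cj P by rewrite -map_mxM PE.
have SE : S *m E = S by rewrite defE mulmxBr mulr2n mulmxDr SP mulmx1 addrK.
have cSE : cj S *m cj E = cj S by rewrite -map_mxM SE.
have cE : cj E = cj P *+ 2 - 1%:M by rewrite defE map_mxB map_mx1 mulr2n map_mxD -mulr2n.
have e : swap_mx N *m cj (graph_mx P S) *m swap_mx N =
    block_mx 1%:M 0 0 (- 1%:M) *m graph_mx P S *m block_mx E 0 0 (- cj E).
  rewrite /graph_mx map_block_mx swap_block_swap diag_block_diag.
  rewrite !map_mxD !map_mxZ !map_mxB !map_mx1 !map_mxK rmorphN rmorphM.
  rewrite /= conji conja conjb; congr block_mx.
  - rewrite mulmxDl -!scalemxAl mulmxBl PE mul1mx defE.
    by apply/matrixP => k l; rewrite !mxE; ring.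
  - by rewrite -scalemxAl cSE mulNr scaleNr.
  - by rewrite -scalemxAl SE mulNr scaleNr.
  - rewrite mulmxDl -!scalemxAl mulmxBl cPE mul1mx cE.
    by apply/matrixP => k l; rewrite !mxE; ring.
have := congr1 determinant e.
rewrite !det_mulmx mulrAC -expr2 det_swap_mx_sqr mul1r det_map_mx.
move=> ->; rewrite !det_ublock det1 mul1r.
rewrite -!scaleN1r !detZ det1 mulr1 det_map_mx.
have nn : (-1 : K) ^+ N * (-1) ^+ N = 1 by rewrite -exprMn mulrNN mulr1 expr1n.
transitivity ((-1 : K) ^+ N * (-1) ^+ N * (\det E * conj (\det E)) *
  \det (graph_mx P S)); first by ring.
by rewrite nn det_involution_conj // !mul1r.
Qed.

Lemma det_exchange_rows m n (u v : 'rV[K]_((1 + m) + (1 + n)))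
    (A : 'M[K]_(m, (1 + m) + (1 + n))) (B : 'M[K]_(n, (1 + m) + (1 + n))) :
  \det (col_mx (col_mx u A) (col_mx v B)) =
  - \det (col_mx (col_mx v A) (col_mx u B)).
Proof.
set M := col_mx (col_mx u A) _; set M' := col_mx (col_mx v A) _.
pose i0 : 'I_((1 + m) + (1 + n)) := lshift (1 + n) (lshift m 0).
pose i1 : 'I_((1 + m) + (1 + n)) := rshift (1 + m) (lshift n 0).
have -> : M = xrow i0 i1 M'.
  apply/matrixP => r c; rewrite /xrow [RHS]mxE permE /=.
  case: (eqVneq r i0) => [->|r0]; last case: (eqVneq r i1) => [->|r1].
  - by rewrite /M /M' /i0 /i1 col_mxEu col_mxEd !col_mxEu.
  - by rewrite /M /M' /i0 /i1 col_mxEu col_mxEd !col_mxEu.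
  - move: r0 r1; rewrite /M /M' /i0 /i1; case: (split_ordP r) => r' ->;
      case: (split_ordP r') => s ->; rewrite ?(col_mxEu, col_mxEd) // (ord1 s) eqxx //.
rewrite xrowE det_mulmx det_perm odd_tperm (_ : i0 != i1) ?expr1 ?mulN1r //.
Qed.

Definition Theta_mx n (z w : 'rV[K]_n.+1) (X : 'M[K]_(n + n, n.+1 + n.+1))
    : 'M[K]_(n.+1 + n.+1) :=
  col_mx (col_mx (row_mx z 0) (usubmx X)) (col_mx (row_mx 0 w) (dsubmx X)).

(** The matrix factors as D0 *m graph_mx P S, where D0 has the rows
    (u, conj u), except for (y, 0) and (0, conj y).  The real structure fixes the
    former and exchanges the latter two. *)
Lemma det_Theta_mx_conj n (P S : 'M[K]_n.+1) (zeta xi : 'rV[K]_n.+1)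
    (X : 'M[K]_(n + n, n.+1 + n.+1)) :
  P *m P = P -> S *m P = S -> cj P *m S = S ->
  zeta *m P = zeta -> xi *m P = 0 -> cj zeta *m S = 0 ->
  (forall r, exists tau beta : 'rV[K]_n.+1,
     [/\ tau *m P = tau, beta *m P = - (b *: (cj tau *m S)) &
         row r X = row_mx (a *: tau + i *: beta)
                          (a *: cj tau + i *: cj beta)]) ->
  let D := Theta_mx (a *: zeta + (i * b) *: xi)
                    (a *: cj zeta + (i * b) *: cj xi) X in
  conj (\det D) = - \det (swap_mx n.+1) * \det D.
Proof.
move=> PP SP PS zP xP zS hX D.
have [tau /fin_all_exists [beta hr]] := fin_all_exists hX.
pose x r := tau r + beta r *m (1%:M - P).
pose y := zeta + b *: xi.
pose XX := \matrix_(r < n + n) row_mx (x r) (cj (x r)).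
pose D0 := Theta_mx y (cj y) XX.
have xS (v : 'rV[K]_n.+1) : v *m P = 0 -> cj v *m S = 0.
  by move=> vP; rewrite -PS mulmxA -map_mxM vP map_mx0 mul0mx.
have xS' (v : 'rV[K]_n.+1) : cj v *m S = 0 -> v *m cj S = 0.
  by move=> vS; rewrite -[v]map_mxK -map_mxM vS map_mx0.
have yS : cj y *m S = 0 by rewrite map_mxD map_mxZ mulmxDl -scalemxAl zS xS ?scaler0 ?addr0.
have yG j : y *m (a *: P + j *: (1%:M - P)) = a *: zeta + (j * b) *: xi.
  rewrite mulmxDr -!scalemxAr mulmxBr mulmx1 mulmxDl -scalemxAl zP xP.
  by apply/matrixP => k l; rewrite !mxE; ring.
have xG j r : x r *m (a *: P + j *: (1%:M - P)) + cj (x r) *m (- (j * b) *: S)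
    = a *: tau r + j *: beta r.
  have [tP bP _] := hr r.
  have P0 : (1%:M - P) *m P = 0 by rewrite mulmxBl mul1mx PP subrr.
  have kS : cj (beta r *m (1%:M - P)) *m S = 0 by apply: xS; rewrite -mulmxA P0 mulmx0.
  have P1 : (1%:M - P) *m (1%:M - P) = 1%:M - P.
    by rewrite mulmxBr P0 mulmx1 subr0.
  have tQ : tau r *m (1%:M - P) = 0 by rewrite mulmxBr mulmx1 tP subrr.
  have bQ : beta r *m (1%:M - P) = beta r + b *: (cj (tau r) *m S).
    by rewrite mulmxBr mulmx1 bP opprK.
  rewrite /x; move: (1%:M - P) P0 kS P1 tQ bQ => Q P0 kS P1 tQ bQ.
  rewrite map_mxD -scalemxAr (mulmxDl (cj _)) kS addr0 mulmxDl !mulmxDr.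
  rewrite -!scalemxAr -!mulmxA P0 P1 mulmx0 scaler0 add0r tP tQ bQ.
  by apply/matrixP => k l; rewrite !mxE; ring.
have yG' : cj y *m (a *: cj P + i *: (1%:M - cj P)) = a *: cj zeta + (i * b) *: cj xi.
  move: (y) (yG (- i)) => v /(congr1 cj).
  rewrite map_mxM !map_mxD !map_mxZ !map_mxB map_mx1.
  by rewrite rmorphM rmorphN /= conji conja conjb opprK.
have xG' r : x r *m (- (i * b) *: cj S) + cj (x r) *m (a *: cj P + i *: (1%:M - cj P))
    = a *: cj (tau r) + i *: cj (beta r).
  move: (x r) (xG (- i) r) => v /(congr1 cj).
  rewrite !map_mxD !map_mxM !map_mxD !map_mxZ !map_mxB map_mx1 map_mxK.
  by rewrite !(rmorphN, rmorphM) /= conji conja conjb opprK addrC.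
have D0G : D = D0 *m graph_mx P S.
  have XG : XX *m graph_mx P S = X.
    apply/row_matrixP => r; rewrite row_mul rowK mul_row_block xG xG'.
    by have [_ _ ->] := hr r.
  rewrite /D0 /Theta_mx mul_col_mx; congr col_mx.
    apply: etrans (esym (mul_col_mx (row_mx y 0) (usubmx XX) _)).
    rewrite mul_usub_mx XG mul_row_block !mul0mx !addr0 yG.
    by rewrite -scalemxAr xS' // scaler0.
  apply: etrans (esym (mul_col_mx (row_mx 0 (cj y)) (dsubmx XX) _)).
  rewrite mul_dsub_mx XG mul_row_block !mul0mx !add0r yG'.
  by rewrite -scalemxAr yS scaler0.
have D0c : cj D0 *m swap_mx n.+1 =
    col_mx (col_mx (row_mx 0 (cj y)) (usubmx XX)) (col_mx (row_mx y 0) (dsubmx XX)).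
  have Xc : cj XX *m swap_mx n.+1 = XX.
    apply/row_matrixP => r; rewrite row_mul -map_row !rowK map_row_mx mul_swap_mx.
    by rewrite map_mxK.
  rewrite /D0 /Theta_mx map_col_mx mul_col_mx; congr col_mx.
    apply: etrans (congr1 (mulmx^~ _) (map_col_mx conj (row_mx y 0) (usubmx XX))) _.
    rewrite mul_col_mx map_row_mx mul_swap_mx map_mx0 map_usubmx mul_usub_mx.
    by rewrite Xc.
  apply: etrans (congr1 (mulmx^~ _) (map_col_mx conj (row_mx 0 (cj y)) (dsubmx XX))) _.
  rewrite mul_col_mx map_row_mx mul_swap_mx map_mx0 map_mxK map_dsubmx mul_dsub_mx.
  by rewrite Xc.
move/(congr1 determinant): D0c; rewrite det_mulmx det_map_mx.
rewrite (det_exchange_rows (row_mx 0 (cj y))) -/(\det D0) => cD0.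
rewrite D0G det_mulmx rmorphM det_graph_mx_conj // mulrA; congr (_ * _).
rewrite -[conj _]mulr1 -(det_swap_mx_sqr n.+1) expr2 mulrA [conj _ * _]cD0.
by rewrite !mulNr [in RHS]mulrC.
Qed.
End PhaseAlgebra.

(** * Complex submanifolds are austere *)
Section GramProjection.
Variables (R : realType) (k n : nat).
Local Notation C := R[i].
Local Notation cj := (map_mx conjc).

(** With B' the conjugate transpose of B, this allows to form the orthogonal
    projection B' (B B')^-1 B onto the row space of B. *)
Lemma gram_unit m N (B : 'M[C]_(m, N)) : row_free B -> B *m (cj B)^T \in unitmx.
Proof.
move=> fB; rewrite -row_free_unit; apply: inj_row_free => v vH.
have : cdot (v *m B) (cconj (v *m B)) = 0.
  rewrite cdotE [cconj _]map_mxM trmx_mul mulmxA.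
  by rewrite -(mulmxA v) vH mul0mx mxE.
move=> /cdot_self_eq0 e; apply: (row_free_inj fB).
by rewrite e mul0mx.
Qed.

(** T below is the shape operator expressed in C^(n+1): the coordinates of a
    vector of the row space of B are conjugated, multiplied by the second
    fundamental form Qh, and turned back into a vector. *)
Lemma Theta_phase (a b : R) (zeta xi : 'rV[C]_n.+1) (S : 'M[C]_(k, n.+1)) (Q : 'M[C]_k)
    (X : 'M[C]_(n + n, n.+1 + n.+1)) :
  row_free (col_mx zeta S) -> cdot xi (cconj zeta) = 0 ->
  (forall j, cdot xi (cconj (row j S)) = 0) ->
  (forall r, exists (c : C) (v : 'rV[C]_k) (be : 'rV[C]_n.+1),
     let tau := c *: zeta + v *m S in
     [/\ cdot be (cconj zeta) = 0,
         forall j, cdot be (cconj (row j S)) = - (b%:C * (cconj v *m Q) 0 j) &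
         row r X = row_mx (a%:C *: tau + 'i *: be)
                          (a%:C *: cconj tau + 'i *: cconj be)]) ->
  let D := Theta_mx (a%:C *: zeta + ('i * b%:C) *: xi)
                    (a%:C *: cconj zeta + ('i * b%:C) *: cconj xi) X in
  conjc (\det D) = - \det (swap_mx C n.+1) * \det D.
Proof.
move=> fB xz xS hX.
pose B : 'M[C]_(1 + k, n.+1) := col_mx zeta S.
pose H := B *m (cj B)^T.
have uH : H \in unitmx by exact: gram_unit.
have cHE : cj H = cj B *m B^T.
  by rewrite map_mxM map_trmx (map_mxK (conj := conjc) (@conjcK R)).
have ucH : cj H \in unitmx by rewrite map_unitmx.
pose Qh : 'M[C]_(1 + k) := block_mx 0 0 0 Q.
pose P := (cj B)^T *m invmx H *m B.
pose T := B^T *m invmx (cj H) *m Qh *m invmx H *m B.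
have BP : B *m P = B by rewrite /P !mulmxA -/H mulmxV // mul1mx.
have cBT : cj B *m T = Qh *m invmx H *m B.
  by rewrite /T !mulmxA -cHE mulmxV // mul1mx.
have PP : P *m P = P by rewrite {1}/P -mulmxA BP.
have TP : T *m P = T by rewrite {1}/T -mulmxA BP.
have cPT : cj P *m T = T.
  rewrite [cj P]map_mxM map_mxM -mulmxA cBT map_invmx map_trmx.
  by rewrite (map_mxK (conj := conjc) (@conjcK R)) /T !mulmxA.
have zB : zeta = row_mx 1%:M 0 *m B by rewrite mul_row_col mul1mx mul0mx addr0.
have uB (u : 'rV[C]_n.+1) : u *m (cj B)^T =
    row_mx (cdot u (cconj zeta))%:M (\row_j cdot u (cconj (row j S))).
  rewrite map_col_mx tr_col_mx mul_mx_row; congr row_mx.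
    by rewrite [LHS]mx11_scalar cdotE.
  apply/rowP => j; rewrite [RHS]mxE cdotE !mxE; apply: eq_bigr => l _.
  by rewrite !mxE.
apply: (det_Theta_mx_conj (conj := conjc) (@conjcK R) _ (conjc_real a) (conjc_real b)
   PP TP cPT).
- exact: (conjCi C).
- by rewrite zB -mulmxA BP.
- rewrite /P !mulmxA uB xz (_ : \row_j _ = 0) ?raddf0 ?row_mx0 ?mul0mx //.
  by apply/rowP => j; rewrite !mxE xS.
- rewrite zB map_mxM -mulmxA cBT !mulmxA map_row_mx mul_row_block map_mx0.
  by rewrite !mulmx0 mul0mx !addr0 row_mx0 !mul0mx.
move=> r; have [c [v [be [bz bS eX]]]] := hX r.
have tauB : c *: zeta + v *m S = row_mx c%:M v *m B.
  by rewrite mul_row_col mul_scalar_mx.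
exists (c *: zeta + v *m S), be; split=> //.
  by rewrite tauB -mulmxA BP.
rewrite tauB map_mxM -mulmxA cBT /P !mulmxA uB bz.
rewrite map_row_mx mul_row_block !mulmx0 !addr0 add0r.
rewrite !scalemxAl -!mulNmx; congr (_ *m _ *m _).
rewrite scale_row_mx opp_row_mx scaler0 oppr0; congr row_mx; first by rewrite raddf0.
by apply/rowP => j; rewrite !mxE bS !mxE.
Qed.

End GramProjection.

(** As zeta lies in the tangent space of the cone, the term r zeta of
    [Phi_velocity] is absorbed in the coefficient c.  Of be, only the component
    in that tangent space is determined by v. *)
Lemma tangent_PhiN_form (R : realType) (n k : nat) (M : manifold R (k + k))
    (F : M -> CP R n) (p : M) (zeta xi : 'rV[R[i]]_n.+1) :
  complex_submanifold F -> normal_rep F p zeta xi ->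
  let a := cosh (cnorm xi / cnorm zeta) in
  let b := sinhc (cnorm xi / cnorm zeta) in
  exists (S : 'M[R[i]]_(k, n.+1)) (Q : 'M[R[i]]_k),
  [/\ Q^T = Q, row_free (col_mx zeta S),
      forall j, cdot xi (cconj (row j S)) = 0 &
      forall X, tangent_PhiN F p zeta xi X ->
        exists (c : R[i]) (v : 'rV[R[i]]_k) (be : 'rV[R[i]]_n.+1),
        let tau := c *: zeta + v *m S in
        [/\ cdot be (cconj zeta) = 0,
            forall j, cdot be (cconj (row j S)) = - (b%:C * (cconj v *m Q) 0 j) &
            X = row_mx (a%:C *: tau + 'i *: be)
                       (a%:C *: cconj tau + 'i *: cconj be)]].
Proof.
move=> cF nr a b; have [S [Q [Qs fS xS hS]]] := complex_normal_data cF nr.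
have [hz xz _] := nr; exists S, Q; split=> //.
move=> X [I [c [u [zt [xt [[oI I0] [su sz sx] hI [up z0 x0] ->]]]]]].
have [d [v [dz dxz dxS]]] := hS I c u zt xt oI I0 su sz sx hI up z0 x0.
have nz : zt 0 != 0 by rewrite z0; have [] := hz.
have [r [s]] := Phi_velocity (csmooth_on_derive (1 : R) sz I0)
  (csmooth_on_derive (1 : R) sx I0) nz.
rewrite z0 x0 -/a -/b => ->.
have a0 : a%:C != 0 by rewrite fmorph_eq0 gt_eqF // cosh_gt0.
exists (d + r%:C / a%:C), v, (b%:C *: cvderive (1 : R) xt 0 + s%:C *: xi).
have e : a%:C *: ((d + r%:C / a%:C) *: zeta + v *m S) =
         a%:C *: cvderive (1 : R) zt 0 + r%:C *: zeta.
  rewrite dz; apply/rowP => j; move: (v *m S) => vS; rewrite !mxE.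
  by field; exact: a0.
split.
- by rewrite cdotDl !cdotZl dxz xz !mulr0 addr0.
- by move=> j; rewrite cdotDl !cdotZl dxS xS mulr0 addr0 mulrN.
have eZ y : a%:C *: cconj y = cconj (a%:C *: y) :> 'rV[R[i]]_n.+1.
  by rewrite cconjZ conjc_real.
by rewrite eZ e.
Qed.

Lemma cdot_mulmx (R : realType) k n (u : 'rV[R[i]]_n) (v : 'rV[R[i]]_k)
    (S : 'M[R[i]]_(k, n)) :
  cdot u (cconj (v *m S)) = \sum_j cconj v 0 j * cdot u (cconj (row j S)).
Proof.
rewrite [cconj _]map_mxM cdotE trmx_mul mulmxA mxE; apply: eq_bigr => j _.
rewrite [LHS]mulrC; congr (_ * _); first by rewrite [LHS]mxE.
by rewrite cdotE !mxE; apply: eq_bigr => l _; rewrite !mxE.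
Qed.

(** The identity z . w = |zeta|^2 is cosh^2 - sinh^2 = 1. *)
Lemma cdot_Phi (R : realType) n (zeta xi : 'rV[R[i]]_n.+1) :
  zeta != 0 -> cdot xi (cconj zeta) = 0 ->
  let a := cosh (cnorm xi / cnorm zeta) in
  let b := sinhc (cnorm xi / cnorm zeta) in
  cdot (a%:C *: zeta + ('i * b%:C) *: xi)
       (a%:C *: cconj zeta + ('i * b%:C) *: cconj xi) = cdot zeta (cconj zeta).
Proof.
move=> z0 xz a b; rewrite cdot_zw //.
have nz : cnorm zeta != 0 by rewrite gt_eqF // cnorm_gt0.
have e : b * cnorm xi = sinh (cnorm xi / cnorm zeta) * cnorm zeta.
  rewrite /b /sinhc; case: eqP => [m0|/eqP m0]; last first.
    by rewrite -[X in _ * X](divfK nz) mulrA divfK.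
  move/eqP: (m0); rewrite mulf_eq0 invr_eq0 (negPf nz) orbF => /eqP ->.
  by rewrite mul0r sinh0 mul0r mulr0.
rewrite -!cnorm_sqr -!rmorphM -rmorphB /=; congr (_%:C).
rewrite (_ : b * b * _ = (b * cnorm xi) ^+ 2); last by ring.
rewrite e exprMn -expr2 -mulrBl.
by rewrite cosh_sinh_sqr mul1r.
Qed.

Theorem corollary2 (R : realType) (n k : nat) (M : manifold R (k + k))
    (F : M -> CP R n) :
  complex_submanifold F -> austere F.
Proof.
move=> cF.
(* the sign - det swap_mx is 1 or - 1, and accordingly t is real or imaginary *)
have [phi phiP] : exists phi : R, forall t : R[i],
    conjc t = - \det (swap_mx R[i] n.+1) * t ->
    complex.Im ((cos phi +i* sin phi) * t) = 0.
  have := det_swap_mx_sqr R[i] n.+1; move=> /eqP; rewrite sqrf_eq1 => /orP[] /eqP ->.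
    exists (pi / 2); rewrite cos_pihalf sin_pihalf => -[x y] /eqP.
    rewrite eq_complex /= => /andP[/eqP e _].
    by move: e; rewrite !mul0r !mul1r; lra.
  exists 0; rewrite cos0 sin0 => -[x y] /eqP.
  rewrite eq_complex /= => /andP[_ /eqP e].
  by move: e; rewrite !mul0r ; lra.
exists phi => p zeta xi nr.
have [[z0 _] xz _] := nr.
have [S [Q [Qs fS xS hX]]] := tangent_PhiN_form cF nr.
have pz := cdot_Phi z0 xz.
move: hX pz; set a := cosh _; set b := sinhc _ => hX pz.
have zz0 : cdot zeta (cconj zeta) != 0.
  by apply: contra z0 => /eqP /cdot_self_eq0 ->.
have zx : cdot zeta (cconj xi) = 0 by rewrite -conjc_cdotr xz conjc0.
split=> [X Y /hX[c1 [v1 [be1 [bz1 bS1 ->]]]] /hX[c2 [v2 [be2 [bz2 bS2 ->]]]]|X hXr].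
  have ax c v : cdot (a%:C *: (c *: zeta + v *m S)) (cconj xi) = 0.
    rewrite -conjc_cdotr cconjZ cdotZr cconjD cdotDr cconjZ cdotZr xz mulr0 add0r.
    by rewrite cdot_mulmx big1 ?mulr0 ?conjc0 // => j _; rewrite xS mulr0.
  have sy c v be w : cdot be (cconj zeta) = 0 ->
      (forall j, cdot be (cconj (row j S)) = - (b%:C * (cconj w *m Q) 0 j)) ->
      cdot be (cconj (a%:C *: (c *: zeta + v *m S))) =
      - (a%:C * b%:C) * (cconj w *m Q *m (cconj v)^T) 0 0.
    move=> bz bS; rewrite cconjZ cdotZr cconjD cdotDr cconjZ cdotZr bz mulr0 add0r.
    rewrite cdot_mulmx conjc_real [_ 0 0]mxE mulNr -mulrA -mulrN; congr (_ * _).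
    rewrite mulr_sumr -sumrN; apply: eq_bigr => j _.
    by rewrite bS [_^T _ _]mxE; ring.
  have E c v be : row_mx (a%:C *: (c *: zeta + v *m S) + 'i *: be)
      (a%:C *: cconj (c *: zeta + v *m S) + 'i *: cconj be) =
      row_mx (a%:C *: (c *: zeta + v *m S) + 'i *: be)
      (cconj (a%:C *: (c *: zeta + v *m S)) + 'i *: cconj be).
    by rewrite cconjZ conjc_real.
  rewrite !E; apply: Omega_normal => //; first by rewrite pz.
  rewrite (sy _ _ _ v1) // (sy _ _ _ v2) //; congr (_ * _).
  have tr (A : 'M[R[i]]_1) : A 0 0 = A^T 0 0 by rewrite mxE.
  by rewrite [LHS]tr !trmx_mul trmxK Qs mulmxA.
have hX' r := hX _ (hXr r).
have := Theta_phase fS xz xS hX'.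
set D := Theta_mx _ _ _ => cD.
apply: phiP; rewrite /Theta row_mxKl row_mxKr pz.
rewrite rmorphM /= fmorphV rmorphXn /= conjc_cdotr mulrCA; congr (_ * _).
exact: cD.
Qed.
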